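(* Let $(M,g,\mu)$ be an $n$-dimensional compact weighted Riemannian manifold with $\mu=e^{-\psi}v_g$, let $m>1$, $T>0$, and let $u$ be a positive solution of the porous medium equation $\partial_t u=\Delta_\psi u^m$ on $M\times[0,T]$. Let $N\in(-\infty,\frac{-2}{m-1})\cup[n,+\infty]$ and assume $\mathrm{Ric}_\psi^N\ge0$ on $M$. Then, with $v=\frac{m}{m-1}u^{m-1}$, $$\frac{|\nabla v|^2}{v}-\frac{\partial_t v}{v}\le\frac{a}{t}$$ on $M\times(0,T]$, where $a=a(m,N)$.
   Context: $(M,g)$ is an $n$-dimensional Riemannian manifold (compact, without boundary), $v_g$ is the Riemannian volume measure, $\psi\in C^\infty(M)$, and $\mu=e^{-\psi}v_g$. Weighted Laplacian: $\Delta_\psi=\Delta-\langle\nabla\psi,\nabla\,\cdot\,\rangle$. $N$-weighted Ricci curvature, for $N\in(-\infty,1]\cup[n,+\infty]$: $\mathrm{Ric}_\psi^N:=\mathrm{Ric}_g+\nabla^2\psi-\frac{d\psi\otimes d\psi}{N-n}$; for $N=+\infty$ the last term is interpreted as $0$; for $N=n$ only constant functions $\psi$ are considered and $\mathrm{Ric}_\psi^n:=\mathrm{Ric}_g$. Constant $a$: $a(m,N)=1$ if $N=\infty$, and $a(m,N)=\frac{N(m-1)}{N(m-1)+2}$ if $N\in(-\infty,\frac{-2}{m-1})\cup[n,+\infty)$. *)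

(* Defs.v *)
From mathcomp Require Import all_boot all_order all_algebra.
From mathcomp Require Import all_classical all_reals all_analysis.

Set Implicit Arguments.
Unset Strict Implicit.
Unset Printing Implicit Defensive.

Import Order.TTheory GRing.Theory Num.Theory.
Import numFieldNormedType.Exports.

Local Open Scope classical_set_scope.
Local Open Scope ring_scope.

Definition partial (R : realType) (n : nat) (k : 'I_n) (f : 'rV[R]_n -> R)
    (x : 'rV[R]_n) : R :=
  'D_(delta_mx 0 k) f x.

Fixpoint Ck (R : realType) (n : nat) (d : nat) (U : set 'rV[R]_n)
    (f : 'rV[R]_n -> R) : Prop :=
  (forall x, U x -> {for x, continuous f}) /\
  (if d is d'.+1 then
     forall k : 'I_n,
       (forall x, U x -> derivable f x (delta_mx 0 k)) /\
       Ck d' U (partial k f)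
   else True).

(** [U] is meant to be open: [partial] is a two-sided derivative. *)
Definition smooth (R : realType) (n : nat) (U : set 'rV[R]_n)
    (f : 'rV[R]_n -> R) : Prop :=
  forall d, Ck d U f.

(** Derivative relative to the time set [J]: it is one-sided at an endpoint of
    an interval [J], so that nothing depends on values at times outside [J]. *)
Definition time_quotient (R : realType) (f : R -> R) (t : R) : R -> R :=
  fun s => (s - t)^-1 * (f s - f t).

Definition time_derivable (R : realType) (J : set R) (f : R -> R) (t : R) :=
  cvg (time_quotient f t @ within J (dnbhs t)).

Definition dtime (R : realType) (J : set R) (f : R -> R) (t : R) : R :=
  lim (time_quotient f t @ within J (dnbhs t)).

Fixpoint Ck_spacetime (R : realType) (n : nat) (d : nat) (J : set R)
    (U : set 'rV[R]_n) (w : R -> 'rV[R]_n -> R) : Prop :=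
  {within J `*` U, continuous (fun z : R * 'rV[R]_n => w z.1 z.2)} /\
  (if d is d'.+1 then
     ((forall t x, J t -> U x -> time_derivable J (w^~ x) t) /\
      Ck_spacetime d' J U (fun t x => dtime J (w^~ x) t)) /\
     (forall k : 'I_n,
       (forall t x, J t -> U x -> derivable (w t) x (delta_mx 0 k)) /\
       Ck_spacetime d' J U (fun t => partial k (w t)))
   else True).

Definition smooth_spacetime (R : realType) (n : nat) (J : set R)
    (U : set 'rV[R]_n) (w : R -> 'rV[R]_n -> R) : Prop :=
  forall d, Ck_spacetime d J U w.

(** Smooth [n]-manifold (without boundary) on the space [M], given by a smooth
    atlas: [coord i] is a homeomorphism from the open set [dom i] onto an open
    subset of R^n, with inverse [param i]; the values of [coord i] outside
    [dom i], and of [param i] outside the image, are irrelevant. *)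
Record smooth_manifold (R : realType) (n : nat) (M : topologicalType) := {
  chart : Type ;
  dom : chart -> set M ;
  coord : chart -> M -> 'rV[R]_n ;
  param : chart -> 'rV[R]_n -> M ;
  manifold_hausdorff : hausdorff_space M ;
  manifold_second_countable : @second_countable M ;
  dom_cover : forall p, exists i, dom i p ;
  dom_open : forall i, open (dom i) ;
  im_open : forall i, open (coord i @` dom i) ;
  coordK : forall i p, dom i p -> param i (coord i p) = p ;
  coord_continuous : forall i p, dom i p -> {for p, continuous (coord i)} ;
  param_continuous : forall i x, (coord i @` dom i) x ->
    {for x, continuous (param i)} ;
  transition_smooth : forall i j (k : 'I_n),
    smooth (coord i @` (dom i `&` dom j)) (fun x => coord j (param i x) 0 k)
}.

Arguments chart {R n M} s.
Arguments dom {R n M} s i.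
Arguments coord {R n M} s i p.
Arguments param {R n M} s i x.

Section Manifold.
Context {R : realType} {n : nat} {M : topologicalType}.
Variable A : smooth_manifold R n M.

Definition im (i : chart A) : set 'rV[R]_n := coord A i @` dom A i.

Definition in_chart (i : chart A) (f : M -> R) : 'rV[R]_n -> R :=
  fun x => f (param A i x).

Definition smooth_fun (f : M -> R) : Prop :=
  forall i, smooth (im i) (in_chart i f).

Definition smooth_evolution (J : set R) (u : R -> M -> R) : Prop :=
  forall i, smooth_spacetime J (im i) (fun t => in_chart i (u t)).

Definition transition_jacobian (i j : chart A) (x : 'rV[R]_n) : 'M[R]_n :=
  \matrix_(a, c) partial a (fun y => coord A j (param A i y) 0 c) x.

(** [met i x a b] is g(d_a, d_b) at the point of coordinates [x] in the
    chart [i]; [met_transition] says that the local expressions are those of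
    one covariant 2-tensor on the manifold. *)
Record riemannian_metric := {
  met : chart A -> 'rV[R]_n -> 'M[R]_n ;
  met_smooth : forall i a b, smooth (im i) (fun x => met i x a b) ;
  met_sym : forall i x, im i x -> (met i x)^T = met i x ;
  met_pos : forall i x, im i x -> forall xi : 'rV[R]_n, xi != 0 ->
    0 < (xi *m met i x *m xi^T) 0 0 ;
  met_transition : forall i j p, dom A i p -> dom A j p ->
    let J := transition_jacobian i j (coord A i p) in
    met i (coord A i p) = J *m met j (coord A j p) *m J^T
}.

Variable G : riemannian_metric.

(** g^{ab} *)
Definition cometric (i : chart A) (x : 'rV[R]_n) : 'M[R]_n :=
  invmx (met G i x).

(** Gamma^c_{ab} of the Levi-Civita connection *)
Definition christoffel (i : chart A) (c a b : 'I_n) (x : 'rV[R]_n) : R :=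
  2^-1 * \sum_(e < n) cometric i x c e *
    (partial a (fun y => met G i y b e) x
     + partial b (fun y => met G i y a e) x
     - partial e (fun y => met G i y a b) x).

(** The d_e-component of R(d_a, d_b) d_c, where
    R(X,Y)Z = D_X D_Y Z - D_Y D_X Z - D_[X,Y] Z. *)
Definition riemann (i : chart A) (e c a b : 'I_n) (x : 'rV[R]_n) : R :=
  partial a (christoffel i e b c) x - partial b (christoffel i e a c) x
  + \sum_(h < n) (christoffel i e a h x * christoffel i h b c x
                  - christoffel i e b h x * christoffel i h a c x).

(** Ric(Y, Z) is the trace of X |-> R(X, Y)Z. *)
Definition ricci (i : chart A) (x : 'rV[R]_n) : 'M[R]_n :=
  \matrix_(b, c) \sum_(a < n) riemann i a c a b x.

Definition hessian (i : chart A) (f : M -> R) (x : 'rV[R]_n) : 'M[R]_n :=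
  \matrix_(a, b) (partial a (partial b (in_chart i f)) x
    - \sum_(c < n) christoffel i c a b x * partial c (in_chart i f) x).

Definition differential (i : chart A) (f : M -> R) (x : 'rV[R]_n) : 'rV[R]_n :=
  \row_a partial a (in_chart i f) x.

(** The following are scalars at the point [p], computed in a chart [i] around
    [p]; for smooth functions they do not depend on [i]. *)
Definition grad_dot (i : chart A) (f h : M -> R) (p : M) : R :=
  let x := coord A i p in
  (differential i f x *m cometric i x *m (differential i h x)^T) 0 0.

Definition laplacian (i : chart A) (f : M -> R) (p : M) : R :=
  let x := coord A i p in
  \tr (cometric i x *m hessian i f x).

Definition weighted_laplacian (psi : M -> R) (i : chart A) (f : M -> R)
    (p : M) : R :=
  laplacian i f p - grad_dot i psi f p.

(** Only meant for N in (-oo, 1] or [n, +oo], and for constant [psi] when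
    N = n; the value at N = -oo is a dummy. *)
Definition weighted_ricci (psi : M -> R) (N : \bar R) (i : chart A)
    (x : 'rV[R]_n) : 'M[R]_n :=
  match N with
  | r%:E =>
      if r == n%:R then ricci i x
      else ricci i x + hessian i psi x
           - (r - n%:R)^-1 *:
               ((differential i psi x)^T *m differential i psi x)
  | _ => ricci i x + hessian i psi x
  end.

Definition weighted_ricci_ge0 (psi : M -> R) (N : \bar R) : Prop :=
  forall i x, im i x -> forall xi : 'rV[R]_n,
    0 <= (xi *m weighted_ricci psi N i x *m xi^T) 0 0.

(** Positive classical solution of the porous medium equation on M x [0, T]:
    continuous up to t = 0, and smooth on M x (0, T], where the equation holds.
    No smoothness at t = 0 is required. *)
Definition positive_pme_solution (psi : M -> R) (m T : R) (u : R -> M -> R) :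
    Prop :=
  [/\ forall t p, 0 <= t <= T -> 0 < u t p,
      {within `[0, T] `*` setT, continuous (fun z : R * M => u z.1 z.2)},
      smooth_evolution `]0, T] u &
      forall t i p, 0 < t <= T -> dom A i p ->
        dtime `]0, T] (u^~ p) t
        = weighted_laplacian psi i (fun q => u t q `^ m) p].

End Manifold.

(** N in (-oo, -2/(m-1)) or [n, +oo] *)
Definition admissible_dimension (R : realType) (n : nat) (m : R) (N : \bar R) :
    Prop :=
  (-oo < N < (- 2 / (m - 1))%:E)%E \/ ((n%:R)%:E <= N)%E.

(** The value at N = -oo is a dummy. *)
Definition ab_constant (R : realType) (m : R) (N : \bar R) : R :=
  match N with
  | r%:E => (r * (m - 1)) / (r * (m - 1) + 2)
  | _ => 1
  end.

(* Main.v *)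
From HB Require Import structures.
Require Import Defs.
From mathcomp Require Import all_boot all_order all_algebra.
From mathcomp Require Import all_classical all_reals all_analysis.
From mathcomp Require Import ring lra.

Set Implicit Arguments.
Unset Strict Implicit.
Unset Printing Implicit Defensive.

Import Order.TTheory GRing.Theory Num.Theory.
Import numFieldNormedType.Exports.

Local Open Scope classical_set_scope.
Local Open Scope ring_scope.

Local Notation coord := Defs.coord.

(** The quantity to bound is governed by p = Delta_psi v. In terms of the
    pressure v the equation reads v_t = (m - 1) v p + |grad v|^2, so that
    |grad v|^2 / v - v_t / v = - (m - 1) p ([pressure_equation],
    [ab_quantityE]) and the claim is a lower bound on p. Applying Delta_psi to
    the equation for v and using Bochner's formula gives
      p_t = (m - 1) v Delta_psi p + 2 m <grad v, grad p> + (m - 1) p^2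
            + 2 (|Hess v|^2 + (Ric + Hess psi)(grad v, grad v))
    ([pressure_laplacian_evolution]). By the Cauchy-Schwarz inequality for the
    trace of the Hessian, the hypothesis on the N-weighted Ricci curvature
    bounds the last bracket below by p^2 / N ([bochner_term_ge]). Consider a
    minimum of (t - eps) p on [eps, tau] x M, where 0 < eps < tau < T. If it is
    attained at a time t > eps, then there grad p = 0, Delta_psi p >= 0 and
    p + (t - eps) p_t <= 0, hence p + (t - eps) (m - 1 + 2 / N) p^2 <= 0, which
    forces (m - 1) (t - eps) p >= - a ([minimum_point_bound]). Letting eps tend
    to 0 gives the estimate before the time T, and it extends to T because u_t
    and the space derivatives of u are continuous on ]0, T]
    ([ab_quantity_cvg]).

    The tensor calculus is done by algebra. Bochner's formula is an identity in
    every commutative ring with commuting derivations, for a symmetric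
    invertible matrix g over that ring; it rests on two properties of the
    Christoffel symbols, which make g parallel ([derivation_metric]) and are
    symmetric in their lower indices ([chrisC]). It is applied to the ring of
    smooth functions on ]0, T[ x U, where U is the image of a chart; evaluation
    at a point is a ring morphism that turns the algebraic objects into the geometric ones. In this
    ring time is one more derivation, so that exchanging the time derivative
    and the Laplacian is the commutation of derivations (Schwarz's theorem).

    The functions p of two charts agree on the overlap, because p is determined
    by v, v_t and |grad v|^2; this reduces the invariance of p under changes of
    charts to that of |grad v|^2, a first order quantity
    ([grad_dot_change_chart]). *)

(** * Bochner's formula in a ring with commuting derivations *)

Definition derivation (S : comPzRingType) (D : S -> S) : Prop :=
  (forall f g, D (f + g) = D f + D g) /\
  (forall f g, D (f * g) = D f * g + f * D g).

Section Derivation.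
Context {S : comPzRingType} {D : S -> S} (derD : derivation D).

Lemma derivationD f g : D (f + g) = D f + D g. Proof. by case: derD. Qed.

Lemma derivationM f g : D (f * g) = D f * g + f * D g. Proof. by case: derD. Qed.

Lemma derivation0 : D 0 = 0.
Proof. by apply: (@addrI _ (D 0)); rewrite -derivationD !addr0. Qed.

Lemma derivation1 : D 1 = 0.
Proof.
by apply: (@addrI _ (D 1)); rewrite -{1}[D 1]mulr1 -{2}[D 1]mul1r -derivationM mulr1 addr0.
Qed.

Lemma derivationN f : D (- f) = - D f.
Proof. by apply: (@addrI _ (D f)); rewrite -derivationD !subrr derivation0. Qed.

Lemma derivationB f g : D (f - g) = D f - D g.
Proof. by rewrite derivationD derivationN. Qed.

Lemma derivation_sum I (r : seq I) (P : pred I) (F : I -> S) :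
  D (\sum_(i <- r | P i) F i) = \sum_(i <- r | P i) D (F i).
Proof. by elim/big_rec2: _ => [|i x y _ <-]; rewrite ?derivation0 ?derivationD. Qed.

Lemma derivation_mx1 p : map_mx D (1%:M : 'M[S]_p) = 0.
Proof.
apply/matrixP => i j; rewrite !mxE; case: (i == j) => /=.
  by rewrite mulr1n derivation1.
by rewrite mulr0n derivation0.
Qed.

Lemma derivation_mxM p q r (A : 'M[S]_(p, q)) (B : 'M[S]_(q, r)) :
  map_mx D (A *m B) = map_mx D A *m B + A *m map_mx D B.
Proof.
apply/matrixP => i j; rewrite !mxE derivation_sum -big_split /=.
by apply: eq_bigr => k _; rewrite derivationM !mxE.
Qed.

Lemma derivation_mxD p q (A B : 'M[S]_(p, q)) :
  map_mx D (A + B) = map_mx D A + map_mx D B.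
Proof. by apply/matrixP => i j; rewrite !mxE derivationD. Qed.

Lemma derivation_tr p (A : 'M[S]_p) : D (\tr A) = \tr (map_mx D A).
Proof. by rewrite derivation_sum; apply: eq_bigr => i _; rewrite mxE. Qed.

End Derivation.

Section Bochner.
Context {S : comPzRingType} {n : nat}.
Context (d : 'I_n -> S -> S) (half : S) (g A : 'M[S]_n) (psi : S).
Context (der : forall a, derivation (d a))
  (dC : forall a b f, d a (d b f) = d b (d a f))
  (halfP : half + half = 1)
  (gT : g^T = g) (AT : A^T = A) (gA : g *m A = 1%:M).

Definition gradient (f : S) : 'cV[S]_n := \col_a d a f.

Definition dot (f h : S) : S := ((gradient f)^T *m A *m gradient h) 0 0.

(** The names from here to [ric] follow those of the geometric objects in a
    chart, with functions replaced by ring elements. *)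
Definition chris (c a b : 'I_n) : S :=
  half * \sum_(e < n) A c e * (d a (g b e) + d b (g a e) - d e (g a b)).

(** The matrix of the covariant derivative in direction [a] on vectors: on
    columns of components it is [d a + connection a]. *)
Definition connection (a : 'I_n) : 'M[S]_n := \matrix_(b, e) chris b a e.

Definition hess (f : S) : 'M[S]_n :=
  \matrix_(a, b) (d a (d b f) - \sum_(c < n) chris c a b * d c f).

Definition lap (f : S) : S := \tr (A *m hess f).

Definition wlap (f : S) : S := lap f - dot psi f.

Definition riem (e c a b : 'I_n) : S :=
  d a (chris e b c) - d b (chris e a c)
  + \sum_(h < n) (chris e a h * chris h b c - chris e b h * chris h a c).

Definition ric : 'M[S]_n := \matrix_(b, c) \sum_(a < n) riem a c a b.

Lemma chrisC c a b : chris c a b = chris c b a.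
Proof.
rewrite /chris; congr (_ * _); apply: eq_bigr => e _; congr (_ * (_ - _)).
  by rewrite addrC.
by rewrite -[in LHS]gT mxE.
Qed.

Lemma hessT f : (hess f)^T = hess f.
Proof.
apply/matrixP => a b; rewrite !mxE dC; congr (_ - _).
by apply: eq_bigr => c _; rewrite chrisC.
Qed.

(** Lowering the upper index of the Christoffel symbols cancels the inverse
    metric of their definition. *)
Lemma connection_lower a b c :
  (g *m connection a) b c = half * (d a (g c b) + d c (g a b) - d b (g a c)).
Proof.
pose E e := d a (g c e) + d c (g a e) - d e (g a c).
have -> : (g *m connection a) b c = half * (g *m (A *m \col_e E e)) b 0.
  rewrite !mxE big_distrr /=; apply: eq_bigr => k _.
  rewrite !mxE mulrCA; congr (_ * (_ * _)); apply: eq_bigr => e _.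
  by rewrite !mxE.
by rewrite mulmxA gA mul1mx mxE.
Qed.

(** The metric is parallel: the three derivatives of the metric in each of the
    two lowered Christoffel symbols add up to a single one. *)
Lemma derivation_metric a : map_mx (d a) g = g *m connection a + (connection a)^T *m g.
Proof.
have gC i j : g i j = g j i by rewrite -[in LHS]gT mxE.
apply/matrixP => b c; rewrite !mxE.
have -> : \sum_j (connection a)^T b j * g j c = (g *m connection a) c b.
  by rewrite !mxE; apply: eq_bigr => j _; rewrite !mxE mulrC (gC j c).
have -> : \sum_j g b j * connection a j c = (g *m connection a) b c by rewrite !mxE.
rewrite !connection_lower (gC c b) (gC a b) (gC a c) -[LHS]mul1r -halfP; ring.
Qed.

Lemma Ag : A *m g = 1%:M.
Proof. by rewrite -AT -gT -trmx_mul gA trmx1. Qed.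

Lemma derivation_cometric a : map_mx (d a) A = - (connection a *m A) - A *m (connection a)^T.
Proof.
have /eqP := derivation_mxM (der a) A g.
rewrite Ag (derivation_mx1 (der a)) eq_sym addr_eq0 => /eqP DAg.
rewrite -[LHS]mulmx1 -gA mulmxA DAg derivation_metric mulmxDr !mulmxA Ag mul1mx.
by rewrite mulNmx mulmxDl opprD -!mulmxA gA mulmx1.
Qed.

Definition gradvec (f : S) : 'cV[S]_n := A *m gradient f.

Lemma cov_gradient a f :
  map_mx (d a) (gradient f) = col a (hess f) + (connection a)^T *m gradient f.
Proof.
apply/matrixP => b z; rewrite !mxE (dC b a).
rewrite -[LHS](subrK (\sum_(c < n) chris c b a * d c f)); congr (_ + _).
by apply: eq_bigr => c _; rewrite !mxE chrisC.
Qed.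

(** The Hessian is the covariant derivative of the differential; as the metric is
    parallel, raising the index gives the covariant derivative of the gradient
    vector. *)
Lemma cov_gradvec a f :
  map_mx (d a) (gradvec f) + connection a *m gradvec f = col a (A *m hess f).
Proof.
rewrite /gradvec (derivation_mxM (der a)) cov_gradient derivation_cometric.
rewrite mulmxBl mulmxDr mulNmx -!mulmxA.
have -> : A *m col a (hess f) = col a (A *m hess f).
  by rewrite !colE mulmxA.
set X := connection a *m _; set Y := A *m (_ *m _).
rewrite [_ + Y]addrC addrA subrK addrAC addNr.
by rewrite add0r.
Qed.

Definition divergence (W : 'cV[S]_n) : S :=
  \sum_a (map_mx (d a) W + connection a *m W) a 0.

(** The Laplacian is a divergence, by [cov_gradvec]. In this form it can be
    applied to the gradient of [dot f f] without a product rule for Hessians. *)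
Lemma lap_divergence f : lap f = divergence (gradvec f).
Proof.
by rewrite /lap /divergence; apply: eq_bigr => a _; rewrite cov_gradvec [RHS]mxE.
Qed.

Definition curvature (a c : 'I_n) : 'M[S]_n :=
  map_mx (d a) (connection c) - map_mx (d c) (connection a)
  + (connection a *m connection c - connection c *m connection a).

(** The curvature as the commutator of covariant derivatives, in matrix form. *)
Lemma curvatureE a c e h : curvature a c e h = riem e h a c.
Proof.
rewrite !mxE /riem; congr (_ + _); rewrite -sumrB.
by apply: eq_bigr => k _; rewrite !mxE.
Qed.

Lemma dotE f h : dot f h = ((gradient f)^T *m gradvec h) 0 0.
Proof. by rewrite /dot /gradvec mulmxA. Qed.

Lemma dotC f h : dot f h = dot h f.
Proof.
have tr00 (X : 'M[S]_1) : X 0 0 = X^T 0 0 by rewrite mxE.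
by rewrite /dot tr00 !trmx_mul trmxK AT mulmxA.
Qed.

(** Compatibility with the metric: the Christoffel terms of the two factors
    cancel. *)
Lemma gradient_dot f h :
  gradient (dot f h) = hess f *m gradvec h + hess h *m gradvec f.
Proof.
apply/matrixP => a z; rewrite ord1 {z} [LHS]mxE dotE.
have -> (M : 'M[S]_1) : d a (M 0 0) = map_mx (d a) M 0 0 by rewrite mxE.
rewrite (derivation_mxM (der a)) -map_trmx cov_gradient.
have /(canRL (addrK _)) -> := cov_gradvec a h.
rewrite linearD /= trmx_mul trmxK mulmxDl mulmxBr -!mulmxA addrACA subrr addr0.
have -> F : col a (hess F) = (row a (hess F))^T by rewrite tr_row hessT.
rewrite trmxK -row_mul [LHS]mxE [RHS]mxE [X in X + _]mxE; congr (_ + _).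
have tr00 (X : 'M[S]_1) : X 0 0 = X^T 0 0 by rewrite mxE.
rewrite tr00 trmx_mul trmxK tr_col trmx_mul hessT AT row_mul -mulmxA.
by rewrite -row_mul mxE. 
Qed.

Lemma col_connection a c : col c (connection a) = col a (connection c).
Proof. by apply/matrixP => b z; rewrite !mxE chrisC. Qed.

(** Covariant derivative of an endomorphism. *)
Definition cov_mx a (B : 'M[S]_n) : 'M[S]_n :=
  map_mx (d a) B + (connection a *m B - B *m connection a).

(** The trace is invariant under conjugation, so the commutator drops out. *)
Lemma tr_cov_mx a B : \tr (cov_mx a B) = d a (\tr B).
Proof.
by rewrite linearD linearB /= [\tr (B *m _)]mxtrace_mulC subrr addr0 (derivation_tr (der a)).
Qed.

Lemma divergence_mulmx B W : divergence (B *m W) =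
  \sum_a \sum_c cov_mx a B a c * W c 0
  + \sum_a (B *m (map_mx (d a) W + connection a *m W)) a 0.
Proof.
rewrite -big_split /=; apply: eq_bigr => a _.
have -> : \sum_c cov_mx a B a c * W c 0 = (cov_mx a B *m W) a 0 by rewrite mxE.
transitivity ((cov_mx a B *m W
  + B *m (map_mx (d a) W + connection a *m W)) a 0); last by rewrite mxE.
congr (fun_of_matrix _ a 0).
rewrite (derivation_mxM (der a)) mulmxDr /cov_mx !mulmxDl mulNmx !mulmxA.
set X := map_mx _ B *m W; set Y := B *m map_mx _ W; set Z := connection a *m B *m W.
by rewrite -[RHS]addrA [Y + _]addrC subrKA -addrA [Y + Z]addrC.
Qed.

(** Both sides are second covariant derivatives of the gradient vector, up to
    the term [B *m col c (connection a)], which is symmetric in [a] and [c]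
    because the connection is torsion free; commuting the two derivatives leaves
    the curvature. *)
Lemma ricci_identity f a c :
  col c (cov_mx a (A *m hess f)) =
  col a (cov_mx c (A *m hess f)) + curvature a c *m gradvec f.
Proof.
have step p q : col q (cov_mx p (A *m hess f)) =
    map_mx (d p) (map_mx (d q) (gradvec f)) + map_mx (d p) (connection q) *m gradvec f
    + (connection q *m map_mx (d p) (gradvec f) + connection p *m map_mx (d q) (gradvec f))
    + connection p *m connection q *m gradvec f
    - A *m hess f *m col q (connection p).
  rewrite /cov_mx linearD linearB /= -map_col -cov_gradvec.
  rewrite (derivation_mxD (der p)) (derivation_mxM (der p)).
  have colM (X Y : 'M[S]_n) : col q (X *m Y) = X *m col q Y by rewrite !colE mulmxA.
  rewrite !colM -(colM A) -cov_gradvec mulmxDr !mulmxA !addrA.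
  by congr (_ + _); congr (_ + _); rewrite -!addrA.
rewrite !step col_connection /curvature !mulmxDl !mulNmx.
have -> : map_mx (d a) (map_mx (d c) (gradvec f)) =
    map_mx (d c) (map_mx (d a) (gradvec f)).
  by apply/matrixP => i j; rewrite ![map_mx _ _ _ _]mxE dC.
apply/matrixP => i j.
rewrite ![(_ + _ : matrix _ _ _) _ _]mxE ![(- _ : matrix _ _ _) _ _]mxE; ring.
Qed.

(** The contraction of [ricci_identity] that makes the derivative of the
    Laplacian appear. As the curvature acts on vectors, not on covectors, its
    trace is the Ricci tensor by definition. *)
Lemma divergence_hess_gradvec f : divergence (A *m hess f *m gradvec f) =
  \tr (A *m hess f *m (A *m hess f)) + dot f (lap f)
  + ((gradvec f)^T *m ric *m gradvec f) 0 0.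
Proof.
rewrite divergence_mulmx addrC -addrA; congr (_ + _).
  apply: eq_bigr => a _; rewrite cov_gradvec !colE !mulmxA.
  by rewrite -colE mxE.
rewrite dotC dotE exchange_big /= -mulmxA ![in RHS]mxE -big_split /=.
apply: eq_bigr => c _; rewrite -big_distrl /=.
have -> : \sum_a cov_mx a (A *m hess f) a c =
    d c (lap f) + (ric *m gradvec f) c 0.
  rewrite -tr_cov_mx mxE.
  have -> : \sum_j ric c j * gradvec f j 0 =
      \sum_a (curvature a c *m gradvec f) a 0.
    under [RHS]eq_bigr do rewrite mxE.
    rewrite exchange_big /=; apply: eq_bigr => e _.
    rewrite mxE big_distrl /=.
    by apply: eq_bigr => a _; rewrite curvatureE.
  rewrite -big_split /=; apply: eq_bigr => a _.
  have := ricci_identity f a c => /matrixP /(_ a 0).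
  by rewrite mxE => ->; rewrite mxE [X in X + _]mxE.
by rewrite mulrDl !mxE [X in _ + X]mulrC.
Qed.

Lemma gradvecD f h : gradvec (f + h) = gradvec f + gradvec h.
Proof.
rewrite /gradvec -mulmxDr; congr (_ *m _).
by apply/matrixP => i j; rewrite !mxE (derivationD (der i)).
Qed.

Lemma hessD f h : hess (f + h) = hess f + hess h.
Proof.
apply/matrixP => a b; rewrite !mxE !(derivationD (der _)) addrACA -opprD.
congr (_ - _); rewrite -big_split /=; apply: eq_bigr => c _.
by rewrite (derivationD (der _)) mulrDr.
Qed.

Lemma lapD f h : lap (f + h) = lap f + lap h.
Proof. by rewrite /lap hessD mulmxDr linearD. Qed.

Lemma dotDr f h k : dot f (h + k) = dot f h + dot f k.
Proof. by rewrite !dotE gradvecD mulmxDr [LHS]mxE. Qed.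

Lemma wlapD f h : wlap (f + h) = wlap f + wlap h.
Proof. rewrite /wlap lapD dotDr; ring. Qed.

Lemma gradientM f h : gradient (f * h) = f *: gradient h + h *: gradient f.
Proof.
by apply/matrixP => i j; rewrite !mxE (derivationM (der i)) addrC [h * _]mulrC.
Qed.

Lemma dotMr f h k : dot f (h * k) = h * dot f k + k * dot f h.
Proof. by rewrite /dot gradientM mulmxDr -!scalemxAr !mxE. Qed.

Lemma hessM f h : hess (f * h) = f *: hess h + h *: hess f
  + (gradient f *m (gradient h)^T + gradient h *m (gradient f)^T).
Proof.
apply/matrixP => a b; rewrite !mxE !big_ord1 !mxE.
have -> : \sum_(c < n) chris c a b * d c (f * h) =
    f * (\sum_(c < n) chris c a b * d c h) + h * \sum_(c < n) chris c a b * d c f.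
  rewrite !big_distrr -big_split /=; apply: eq_bigr => c _.
  by rewrite (derivationM (der c)); ring.
rewrite !(derivationM (der _)) !(derivationD (der _)) !(derivationM (der _)).
ring.
Qed.

Lemma tr_outer f h : \tr (A *m (gradient f *m (gradient h)^T)) = dot f h.
Proof. by rewrite mulmxA mxtrace_mulC mulmxA trace_mx11 dotC. Qed.

Lemma lapM f h : lap (f * h) = f * lap h + h * lap f + (dot f h + dot f h).
Proof.
rewrite /lap hessM !mulmxDr !linearD /= !tr_outer -!scalemxAr !linearZ /=.
by rewrite [dot h f]dotC.
Qed.

Lemma wlapM f h : wlap (f * h) = f * wlap h + h * wlap f + (dot f h + dot f h).
Proof. rewrite /wlap lapM dotMr; ring. Qed.

Lemma wlap_const c f : (forall a, d a c = 0) -> wlap (c * f) = c * wlap f.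
Proof.
move=> dc0.
have gc0 : gradient c = 0 by apply/matrixP => i j; rewrite !mxE dc0.
have dotc0 h : dot h c = 0 by rewrite dotE /gradvec gc0 !mulmx0 mxE.
have hc0 : hess c = 0.
  apply/matrixP => i j; rewrite !mxE dc0 (derivation0 (der _)) sub0r.
  by rewrite big1 ?oppr0// => e _; rewrite dc0 mulr0.
have wc0 : wlap c = 0 by rewrite /wlap /lap hc0 mulmx0 linear0 dotc0 subr0.
by rewrite wlapM wc0 (dotC c) dotc0 mulr0 !addr0.
Qed.

(** Since the gradient of [dot f f] is twice the Hessian of [f] applied to the
    gradient vector, its Laplacian is given by [divergence_hess_gradvec]. The
    drift term [dot psi] produces the Hessian of [psi] and two terms in
    [hess f] that cancel. *)
Theorem bochner f :
  wlap (dot f f) = (\tr (A *m hess f *m (A *m hess f)) + dot f (wlap f)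
    + ((gradvec f)^T *m (ric + hess psi) *m gradvec f) 0 0) *+ 2.
Proof.
have gQ : gradvec (dot f f) = A *m hess f *m gradvec f *+ 2.
  by rewrite {1}/gradvec gradient_dot mulmxDr -mulr2n mulmxA.
have divD W : divergence (W *+ 2) = divergence W *+ 2.
  rewrite !mulr2n /divergence -big_split /=; apply: eq_bigr => a _.
  by rewrite (derivation_mxD (der a)) mulmxDr addrACA [LHS]mxE.
have dotD h : dot h (- dot psi f) = - dot h (dot psi f).
  apply/eqP; rewrite -addr_eq0 -dotDr addNr /dot.
  have -> : gradient 0 = 0.
    by apply/matrixP => i j; rewrite !mxE (derivation0 (der i)).
  by rewrite mulmx0 mxE.
have dotV h k : dot h k = ((gradvec h)^T *m gradient k) 0 0.
  by rewrite /dot /gradvec trmx_mul AT.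
have cross : dot psi (dot f f) =
    ((gradvec f)^T *m (hess f *m gradvec psi)) 0 0 *+ 2.
  rewrite dotE gQ mulr2n mulmxDr mxE -mulr2n; congr (_ *+ 2).
  rewrite [LHS](_ : _ = ((gradient psi)^T *m (A *m hess f *m gradvec f))^T 0 0).
    by rewrite !trmx_mul trmxK hessT AT !mulmxA.
  by rewrite [RHS]mxE.
rewrite {1}/wlap lap_divergence gQ divD divergence_hess_gradvec cross -mulrnBl; congr (_ *+ 2).
rewrite {1}/wlap dotDr dotD [dot f (dot psi f)]dotV gradient_dot.
rewrite !mulmxDr mulmxDl !mulmxA ![(_ + _ : matrix _ _ _) _ _]mxE; ring.
Qed.

Section Pressure.
Context (D : S -> S) (derDt : derivation D)
  (DC : forall a f, D (d a f) = d a (D f))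
  (Dg : forall a b, D (g a b) = 0) (DA : forall a b, D (A a b) = 0)
  (Dpsi : D psi = 0).
Context (u uinv v f k : S) (uV : uinv * u = 1) (dk0 : forall a, d a k = 0)
  (df : forall a, d a f = u * d a v) (dv : forall a, u * d a v = k * v * d a u)
  (Dv : u * D v = k * v * D u) (pme : D u = wlap f).

Lemma D_half : D half = 0.
Proof.
have E : D half + D half = 0 by rewrite -(derivationD derDt) halfP (derivation1 derDt).
by rewrite -[LHS]mul1r -halfP mulrDl -mulrDr E mulr0.
Qed.

Lemma D_chris c a b : D (chris c a b) = 0.
Proof.
rewrite (derivationM derDt) D_half mul0r add0r (derivation_sum derDt) big1 ?mulr0// => e _.
rewrite (derivationM derDt) DA mul0r add0r (derivationB derDt) (derivationD derDt) !DC !Dg.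
by rewrite !(derivation0 (der _)) addr0 subrr mulr0.
Qed.

Lemma D_dot h l : D (dot h l) = dot (D h) l + dot h (D l).
Proof.
have E (M : 'M[S]_1) : D (M 0 0) = map_mx D M 0 0 by rewrite mxE.
have Dgr q : map_mx D (gradient q) = gradient (D q).
  by apply/matrixP => i j; rewrite !mxE DC.
have DA0 : map_mx D A = 0 by apply/matrixP => i j; rewrite !mxE DA.
rewrite /dot E !(derivation_mxM derDt) -map_trmx !Dgr DA0 mulmx0 addr0.
by rewrite [LHS]mxE.
Qed.

Lemma D_lap h : D (lap h) = lap (D h).
Proof.
rewrite /lap (derivation_tr derDt) (derivation_mxM derDt).
have -> : map_mx D A = 0 by apply/matrixP => i j; rewrite !mxE DA.
rewrite mul0mx add0r; congr (\tr (_ *m _)); apply/matrixP => a b.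
rewrite !mxE (derivationB derDt) !DC (derivation_sum derDt); congr (_ - _).
by apply: eq_bigr => c _; rewrite (derivationM derDt) D_chris mul0r add0r DC.
Qed.

(** The metric and the weight do not depend on time. *)
Lemma D_wlap h : D (wlap h) = wlap (D h).
Proof.
rewrite /wlap (derivationB derDt) D_lap D_dot Dpsi.
have -> : dot 0 h = 0; last by rewrite add0r.
rewrite /dot; have -> : gradient 0 = 0.
  by apply/matrixP => i j; rewrite !mxE (derivation0 (der i)).
by rewrite trmx0 !mul0mx mxE.
Qed.

(** The equation for [u] multiplied by the derivative of the pressure law; the
    unknown [f] stands for the power [m] of [u], the hypotheses [df], [dv] and
    [Dv] are the chain rules for the powers of [u], and [k] stands for [m - 1]. *)
Lemma pressure_equation : D v = k * v * wlap v + dot v v.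
Proof.
have gvf : gradient f = u *: gradient v by apply/matrixP => i j; rewrite !mxE df.
have gvu : u *: gradient v = (k * v) *: gradient u.
  by apply/matrixP => i j; rewrite !mxE dv.
have lapf : lap f = u * lap v + dot u v.
  rewrite !lap_divergence /gradvec gvf -scalemxAr -/(gradvec v) dotE mxE.
  rewrite /divergence big_distrr /= -big_split /=; apply: eq_bigr => a _.
  rewrite -scalemxAr ![(_ + _ : matrix _ _ _) _ _]mxE ![(_ *: _ : matrix _ _ _) _ _]mxE.
  by rewrite mxE [(_ *: _ : matrix _ _ _) _ _]mxE (derivationM (der a)) !mxE; ring.
have dotf : dot psi f = u * dot psi v.
  by rewrite /dot gvf -scalemxAr mxE.
have wf : wlap f = u * wlap v + dot u v by rewrite /wlap lapf dotf; ring.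
have dotuv : k * v * dot u v = u * dot v v.
  have scal c h l : c * dot h l = ((gradient h)^T *m A *m (c *: gradient l)) 0 0.
    by rewrite -scalemxAr [RHS]mxE.
  by rewrite [dot u v]dotC !scal gvu.
have uDv : u * D v = u * (k * v * wlap v + dot v v).
  by rewrite Dv pme wf mulrDr dotuv; ring.
by rewrite -[LHS]mul1r -uV -mulrA uDv mulrA uV mul1r.
Qed.

(** [wlap] of [pressure_equation]: the product rule gives the terms with [k],
    and [bochner] the others, with one more [dot v (wlap v)]. *)
Theorem pressure_laplacian_evolution : D (wlap v) =
  k * v * wlap (wlap v) + (k + 1) * dot v (wlap v) *+ 2 + k * wlap v ^+ 2
  + (\tr (A *m hess v *m (A *m hess v))
     + ((gradvec v)^T *m (ric + hess psi) *m gradvec v) 0 0) *+ 2.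
Proof.
rewrite D_wlap pressure_equation wlapD bochner -mulrA wlap_const // wlapM.
ring.
Qed.

End Pressure.
End Bochner.

(** * Positive definite matrices and the curvature-dimension inequality *)

Section PositiveMatrices.
Context {R : rcfType}.

Definition posdef n (A : 'M[R]_n) : Prop :=
  forall xi : 'rV[R]_n, xi != 0 -> 0 < (xi *m A *m xi^T) 0 0.

(** Cholesky factorization, by induction on the size: the Schur complement of
    the first entry is again positive definite. *)
Lemma posdef_factor n (A : 'M[R]_n) :
  A^T = A -> posdef A -> exists C : 'M[R]_n, A = C^T *m C.
Proof.
elim: n => [|n IHn] in A *.
  by move=> _ _; exists 0; apply/matrixP => -[].
rewrite -[n.+1]/(1 + n)%N in A * => AT Apos.
pose a := A 0 0; pose b : 'rV[R]_n := ursubmx A; pose D : 'M[R]_n := drsubmx A.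
have Eul : ulsubmx A = a%:M.
  by apply/matrixP => i j; rewrite !ord1 !mxE /= mulr1n /a; congr (A _ _); apply/val_inj.
have EA : A = block_mx a%:M b b^T D.
  by rewrite -[LHS]submxK Eul /b trmx_ursub AT.
have DT : D^T = D by rewrite /D trmx_drsub AT.
have a_gt0 : 0 < a.
  have /Apos : row_mx (1%:M : 'M[R]_1) (0 : 'rV[R]_n) != 0.
    rewrite row_mx_eq0 negb_and; apply/orP; left.
    by apply/eqP => /matrixP /(_ 0 0); rewrite !mxE /=; apply/eqP/oner_neq0.
  rewrite EA mul_row_block tr_row_mx mul_row_col !trmx0 !mulmx0 trmx1 mulmx1.
  by rewrite mul1mx mul0mx !addr0 mxE mulr1n.
have a_neq0 : a != 0 by rewrite gt_eqF.
pose D' := D - a^-1 *: (b^T *m b).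
have D'T : D'^T = D'.
  by rewrite /D' linearB linearZ /= trmx_mul trmxK DT.
have D'pos : posdef D'.
  move=> eta eta0.
  (* the first entry minimises the form of [A] over all extensions of [eta] *)
  have /Apos : row_mx (- a^-1 *: (eta *m b^T)) eta != 0.
    by rewrite row_mx_eq0 negb_and eta0 orbT.
  rewrite EA mul_row_block tr_row_mx mul_row_col mul_mx_scalar.
  rewrite scalerA mulrN divff// scaleN1r addNr mul0mx add0r -scalemxAl.
  by rewrite /D' mulmxBr -scalemxAr mulmxA scaleNr addrC.
have [C EC] := IHn D' D'T D'pos.
pose r := Num.sqrt a.
have r2 : r * r = a by rewrite -expr2 sqr_sqrtr// ltW.
have r0 : r != 0 by rewrite gt_eqF// sqrtr_gt0.
exists (block_mx r%:M (r^-1 *: b) 0 C).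
rewrite tr_block_mx mulmx_block EA !trmx0 !mulmx0 !mul0mx !addr0.
rewrite tr_scalar_mx -scalar_mxM r2 mul_scalar_mx scalerA divff// scale1r.
rewrite mul_mx_scalar linearZ /= scalerA divff// scale1r -EC.
by rewrite -scalemxAl -scalemxAr scalerA -invfM r2 addrC subrK.
Qed.

Lemma posdef_unit n (A : 'M[R]_n) : posdef A -> A \in unitmx.
Proof.
move=> Apos; rewrite -row_free_unit -kermx_eq0; apply/rowV0P => xi /sub_kermxP xiA.
apply/eqP; apply: contraT => /Apos; by rewrite xiA mul0mx mxE ltxx.
Qed.

Lemma posdef_invmx_factor n (A : 'M[R]_n) : A^T = A -> posdef A ->
  exists C : 'M[R]_n, invmx A = C *m C^T.
Proof.
move=> AT Apos; have [C EC] := posdef_factor AT Apos.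
have := posdef_unit Apos; rewrite EC unitmx_mul => /andP[CTu Cu].
exists (invmx C).
have E : invmx C *m (invmx C)^T *m (C^T *m C) = 1%:M.
  rewrite -mulmxA (mulmxA _ C^T) -trmx_mul mulmxV// trmx1 mul1mx mulVmx//.
have U : C^T *m C \in unitmx by rewrite unitmx_mul CTu Cu.
by rewrite -[LHS]mul1mx -E -mulmxA mulmxV// mulmx1.
Qed.

(** The diagonal entries obey the Cauchy-Schwarz inequality, and the trace of
    [X *m X^T] is the sum of the squares of all entries. *)
Lemma mxtrace_sqr_le n (X : 'M[R]_n) : (\tr X) ^+ 2 <= n%:R * \tr (X *m X^T).
Proof.
case: n X => [|n] X; first by rewrite /mxtrace big_ord0 expr0n /= mul0r.
pose t := \tr X.
have H1 : \sum_i X i i ^+ 2 <= \tr (X *m X^T).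
  apply: ler_sum => i _; rewrite mxE (bigD1 i)//= mxE -expr2 lerDl.
  by apply: sumr_ge0 => j _; rewrite mxE -expr2 sqr_ge0.
apply: le_trans (_ : n.+1%:R * \sum_i X i i ^+ 2 <= _); last first.
  by rewrite ler_pM2l ?ltr0n.
have : 0 <= \sum_i (n.+1%:R * X i i - t) ^+ 2 by apply: sumr_ge0 => i _; rewrite sqr_ge0.
have -> : \sum_i (n.+1%:R * X i i - t) ^+ 2 =
    n.+1%:R * (n.+1%:R * (\sum_i X i i ^+ 2) - t ^+ 2).
  rewrite (eq_bigr (fun i => n.+1%:R ^+ 2 * X i i ^+ 2
    + (- (2 * n.+1%:R * t)) * X i i + t ^+ 2)); last by move=> i _; ring.
  rewrite !big_split /= -!big_distrr /= -/(\tr X) -/t sumr_const card_ord.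
  by rewrite -[t *+ _]mulr_natl; ring.
by rewrite pmulr_rge0 ?ltr0n// subr_ge0.
Qed.

(** With the factorization of [A], this is [mxtrace_sqr_le] for the symmetric
    matrix [C^T *m H *m C], the Hessian in an orthonormal frame. *)
Lemma trace_hessian_sqr_le n (A H : 'M[R]_n) (C : 'M[R]_n) :
  A = C *m C^T -> H^T = H ->
  (\tr (A *m H)) ^+ 2 <= n%:R * \tr (A *m H *m (A *m H)).
Proof.
move=> -> HT; have := mxtrace_sqr_le (C^T *m H *m C).
rewrite !trmx_mul trmxK HT [\tr (C^T *m H *m C)]mxtrace_mulC !mulmxA.
by rewrite [X in _ * X]mxtrace_mulC !mulmxA.
Qed.

Lemma mxtrace_posdef_ge0 n (A H C : 'M[R]_n) : A = C *m C^T ->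
  (forall xi : 'rV[R]_n, 0 <= (xi *m H *m xi^T) 0 0) -> 0 <= \tr (A *m H).
Proof.
move=> -> Hpos; rewrite mxtrace_mulC mulmxA mxtrace_mulC mulmxA.
apply: sumr_ge0 => i _; have := Hpos (row i C^T).
rewrite -row_mul tr_row -[(_ *m col _ _) 0 0]/(_) colE mulmxA -colE.
by rewrite -row_mul trmxK !mxE.
Qed.

End PositiveMatrices.

Section RealInequalities.
Context {R : realFieldType}.

(** The difference of the two sides, once [b] is replaced by its lower bound
    [h ^+ 2 / n%:R], is the square of [(r - n%:R) * h + n%:R * s] divided by
    [n%:R * (r * (r - n%:R))], which is positive in both ranges of [r]. In
    dimension 0 the left-hand side vanishes. *)
Lemma weighted_trace_inequality (n : nat) (r h s b : R) :
  r != n%:R -> r < 0 \/ n%:R <= r -> (n = 0%N -> h = 0 /\ s = 0) ->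
  h ^+ 2 <= n%:R * b -> (n = 0%N -> 0 <= b) ->
  (h - s) ^+ 2 / r <= b + (r - n%:R)^-1 * s ^+ 2.
Proof.
move=> rn rN n0 hb b0.
have [nE|n_gt0] := posnP n.
  have [-> ->] := n0 nE.
  by rewrite subrr expr0n /= mul0r mulr0 addr0 b0.
have nR : 0 < n%:R :> R by rewrite ltr0n.
have r0 : r != 0.
  by case: rN => [/lt_eqF ->//|nr]; rewrite gt_eqF// (lt_le_trans nR).
have rr : 0 < r * (r - n%:R).
  case: rN => [rneg|nr]; first by nra.
  have : n%:R < r by rewrite lt_neqAle eq_sym rn.
  by nra.
have hb' : h ^+ 2 / n%:R <= b by rewrite ler_pdivrMr// mulrC.
apply: le_trans (lerD hb' (lexx _)).
rewrite -subr_ge0.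
have -> : h ^+ 2 / n%:R + (r - n%:R)^-1 * s ^+ 2 - (h - s) ^+ 2 / r =
   ((r - n%:R) * h + n%:R * s) ^+ 2 / (n%:R * (r * (r - n%:R))).
  by field; rewrite r0 subr_eq0 rn gt_eqF.
by rewrite divr_ge0 ?sqr_ge0// ltW// mulr_gt0.
Qed.

(** If [p] is negative, divide [p + tau * (k + 2 / r) * p ^+ 2 <= 0] by [p]; the
    coefficient [k + 2 / r] is positive precisely in the given ranges of [r]. *)
Lemma minimum_bound (k tau p y r : R) : 0 < k -> 0 < tau -> r != 0 ->
  r < - 2 / k \/ 0 < r -> p ^+ 2 / r <= y ->
  p + tau * (k * p ^+ 2 + y *+ 2) <= 0 ->
  - (r * k / (r * k + 2)) <= tau * (k * p).
Proof.
move=> k0 tau0 r0 rk yp H.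
have beta : 0 < k + 2 / r.
  case: rk => [rk|rk]; last by rewrite addr_gt0// divr_gt0.
  have rk2 : r * k < - 2 by rewrite -ltr_pdivlMr.
  have rneg : r < 0 by nra.
  have -> : k + 2 / r = (r * k + 2) / r by field.
  by rewrite -mulrNN -invrN divr_gt0// oppr_gt0 //; lra.
have betaE : k + 2 / r = (r * k + 2) / r by field.
have rk2 : r * k + 2 != 0.
  by apply/eqP => E; move: beta; rewrite betaE E mul0r ltxx.
have -> : r * k / (r * k + 2) = k / (k + 2 / r).
  by field; rewrite r0 mulrC.
have [p0|p0] := leP 0 p.
  apply: (@le_trans _ _ 0); first by rewrite oppr_le0 divr_ge0// ltW.
  by rewrite !mulr_ge0// ltW.
have H2 : p + tau * ((k + 2 / r) * p ^+ 2) <= 0.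
  apply: le_trans H; rewrite lerD2l ler_pM2l// mulrDl lerD2l.
  have -> : 2 / r * p ^+ 2 = (p ^+ 2 / r) *+ 2 by ring.
  by rewrite lerMn2r.
have H3 : 0 <= 1 + tau * ((k + 2 / r) * p).
  rewrite -(nmulr_lle0 _ p0) mulrDl mul1r.
  by apply: le_trans H2; rewrite lerD2l; rewrite le_eqVlt; apply/orP; left; apply/eqP; ring.
rewrite lerNl ler_pdivlMr//.
have -> : - (tau * (k * p)) * (k + 2 / r) = k * - (tau * ((k + 2 / r) * p)).
  by rewrite betaE; ring.
by rewrite -[leRHS]mulr1 ler_pM2l//; lra.
Qed.

(** The limit case of [minimum_bound] where [r] is infinite. *)
Lemma minimum_bound_oo (k tau p y : R) : 0 < k -> 0 < tau -> 0 <= y ->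
  p + tau * (k * p ^+ 2 + y *+ 2) <= 0 -> - 1 <= tau * (k * p).
Proof.
move=> k0 tau0 y0 H.
have [p0|p0] := leP 0 p.
  by apply: (@le_trans _ _ 0); rewrite ?oppr_le0// !mulr_ge0// ltW.
have H2 : p + tau * (k * p ^+ 2) <= 0.
  by apply: le_trans H; rewrite lerD2l ler_pM2l// lerDl mulrn_wge0.
rewrite -subr_ge0 opprK -(nmulr_lle0 _ p0) mulrDl mul1r.
by apply: le_trans H2; rewrite addrC lerD2l; rewrite le_eqVlt; apply/orP; left; apply/eqP; ring.
Qed.

End RealInequalities.

(** * Mean values along lines and the symmetry of second derivatives *)

Section Lines.
Context {R : realType} {V : normedModType R}.
Implicit Types (f : V -> R) (x u v : V).

Lemma is_derive_line f x u s : derivable f (x + s *: u) u ->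
  is_derive s 1 (fun r : R => f (x + r *: u)) ('D_u f (x + s *: u)).
Proof.
have E : (fun h : R => h^-1 *: (((fun r : R => f (x + r *: u)) \o shift s) h%:A
      - f (x + s *: u))) =
    (fun h => h^-1 *: ((f \o shift (x + s *: u)) (h *: u) - f (x + s *: u))).
  by apply/funext => h /=; rewrite [h%:A]mulr1 scalerDl addrCA.
by move=> df; split; rewrite /derivable /derive E.
Qed.

Lemma MVT_line f x u h : 0 < h ->
  (forall s, 0 <= s <= h -> derivable f (x + s *: u) u) ->
  exists2 s, 0 < s < h & f (x + h *: u) - f x = h * 'D_u f (x + s *: u).
Proof.
move=> h0 df.
have [s sh E] : exists2 s, s \in `]0, h[ &
    f (x + h *: u) - f (x + 0 *: u) = 'D_u f (x + s *: u) * (h - 0).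
  apply: (@MVT _ (fun r => f (x + r *: u))) => // [s|].
    by rewrite in_itv /= => /andP[s0 sh]; apply: is_derive_line; apply: df; rewrite !ltW.
  apply: derivable_within_continuous => s; rewrite in_itv /= => sh.
  by have [] := is_derive_line (df s sh).
by exists s => //; move: E; rewrite scale0r addr0 subr0 mulrC.
Qed.

(** Mean value theorem for the increment of [f] in direction [v], as a function
    along [u], and then for the derivative along [u]. *)
Lemma double_difference f x u v h : 0 < h ->
  (forall s r, 0 <= s <= h -> 0 <= r <= h ->
     derivable f (x + s *: u + r *: v) u) ->
  (forall s r, 0 <= s <= h -> 0 <= r <= h ->
     derivable ('D_u f) (x + s *: u + r *: v) v) ->
  exists s r, [/\ 0 <= s <= h, 0 <= r <= h &
    f (x + h *: u + h *: v) - f (x + h *: u) - (f (x + h *: v) - f x)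
     = h * (h * 'D_v ('D_u f) (x + s *: u + r *: v))].
Proof.
move=> h0 dfu dfv.
pose g y := f (y + h *: v) - f y.
have h0h : 0 <= h <= h by apply/andP; split=> //; exact: ltW.
have z0h : 0 <= (0 : R) <= h by rewrite lexx ltW.
have shiftd y : derivable f (y + h *: v) u ->
    is_derive y u (fun z => f (z + h *: v)) ('D_u f (y + h *: v)).
  have E : (fun k : R => k^-1 *: (((fun z => f (z + h *: v)) \o shift y) (k *: u)
        - f (y + h *: v))) =
      (fun k => k^-1 *: ((f \o shift (y + h *: v)) (k *: u) - f (y + h *: v))).
    by apply/funext => k /=; rewrite addrA.
  by move=> df; split; rewrite /derivable /derive E.
have gd s : 0 <= s <= h -> is_derive (x + s *: u) u g
    ('D_u f (x + s *: u + h *: v) - 'D_u f (x + s *: u)).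
  move=> sh; apply: is_deriveB; first by apply: shiftd; apply: dfu.
  by apply/derivableP; have := dfu s 0 sh z0h; rewrite scale0r addr0.
have [|s sh E] := @MVT_line g x u h h0.
  by move=> s /gd[].
have sh' : 0 <= s <= h by case/andP: sh => s0 sh; rewrite !ltW.
have [|r rh E'] := @MVT_line ('D_u f) (x + s *: u) v h h0.
  by move=> r rh; apply: dfv.
exists s, r; split => //; first by case/andP: rh => r0 rh; rewrite !ltW.
rewrite -E'; have [_ <-] := gd s sh'.
by rewrite -E /g; ring.
Qed.

(** All the points at which [double_difference] evaluates the two mixed
    derivatives are near [x]. *)
Lemma small_parallelogram (D : set V) (F G : V -> R) x u v :
  open D -> D x -> {for x, continuous F} -> {for x, continuous G} ->
  forall e, 0 < e -> exists h, [/\ 0 < h &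
    forall s r, 0 <= s <= h -> 0 <= r <= h ->
    [/\ D (x + s *: u + r *: v), `|F x - F (x + s *: u + r *: v)| < e &
        `|G x - G (x + s *: u + r *: v)| < e]].
Proof.
move=> oD Dx cF cG e e0.
have H1 : nbhs x D := open_nbhs_nbhs (conj oD Dx).
have /cvgrPdist_lt /(_ _ e0) H2 := cF.
have /cvgrPdist_lt /(_ _ e0) H3 := cG.
have : nbhs x (D `&` ([set y | `|F x - F y| < e] `&` [set y | `|G x - G y| < e])).
  by apply: filterI H1 _; apply: filterI H2 H3.
rewrite -nbhs_ballE => -[d /= d0 dP].
(* adding 1 keeps the denominator positive when both directions vanish *)
exists (d / (`|u| + `|v| + 1)).
have uv0 : 0 < `|u| + `|v| + 1 by rewrite ltr_wpDl// addr_ge0.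
split; first by rewrite divr_gt0.
move=> s r /andP[s0 sh] /andP[r0 rh].
suff /dP[? [? ?]] : ball x d (x + s *: u + r *: v) by [].
rewrite -ball_normE /ball_ /= -addrA opprD addNKr normrN.
apply: le_lt_trans (ler_normD _ _) _; rewrite !normrZ !ger0_norm//.
apply: (@le_lt_trans _ _ (d / (`|u| + `|v| + 1) * (`|u| + `|v|))).
  by rewrite mulrDr lerD// ler_wpM2r.
by rewrite mulrAC ltr_pdivrMr// ltr_pM2l// ltrDl.
Qed.

Lemma norm_split (a b c e : R) :
  `|a - c| < e / 2 -> `|b - c| < e / 2 -> `|a - b| <= e.
Proof.
rewrite !ltr_norml ler_norml => /andP[H1 H1'] /andP[H2 H2'].
by apply/andP; split; lra.
Qed.

(** The double difference does not depend on the order of the two directions;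
    dividing it by [h ^+ 2] and letting [h] tend to 0 gives each of the two
    mixed derivatives. *)
Lemma schwarz (D : set V) f u v : open D ->
  (forall x, D x -> derivable f x u) -> (forall x, D x -> derivable f x v) ->
  (forall x, D x -> derivable ('D_u f) x v) ->
  (forall x, D x -> derivable ('D_v f) x u) ->
  (forall x, D x -> {for x, continuous ('D_v ('D_u f))}) ->
  (forall x, D x -> {for x, continuous ('D_u ('D_v f))}) ->
  forall x, D x -> 'D_u ('D_v f) x = 'D_v ('D_u f) x.
Proof.
move=> oD dfu dfv dfuv dfvu cuv cvu x Dx.
have mixed h : 0 < h ->
    (forall s r, 0 <= s <= h -> 0 <= r <= h -> D (x + s *: u + r *: v)) ->
    exists s r s' r', [/\ 0 <= s <= h /\ 0 <= r <= h, 0 <= s' <= h /\ 0 <= r' <= h &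
      'D_v ('D_u f) (x + s *: u + r *: v) = 'D_u ('D_v f) (x + s' *: u + r' *: v)].
  move=> h0 hP.
  have [s [r [sh rh E]]] := double_difference h0
    (fun s r sh rh => dfu _ (hP s r sh rh)) (fun s r sh rh => dfuv _ (hP s r sh rh)).
  have hP' p q : 0 <= p <= h -> 0 <= q <= h -> D (x + p *: v + q *: u).
    by move=> ph qh; rewrite addrAC; exact: hP.
  have [r' [s' [rh' sh' E']]] := double_difference h0
    (fun p q ph qh => dfv _ (hP' p q ph qh)) (fun p q ph qh => dfvu _ (hP' p q ph qh)).
  exists s, r, s', r'; split; [exact: conj|exact: conj|].
  apply: (mulfI (lt0r_neq0 h0)); apply: (mulfI (lt0r_neq0 h0)).
  rewrite [x + s' *: u + _]addrAC; apply: etrans (etrans (esym E) _) E'.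
  by rewrite [x + h *: v + _]addrAC !opprB !addrA; ring.
have key := small_parallelogram u v oD Dx (cvu x Dx) (cuv x Dx).
move: mixed key; move: ('D_u ('D_v f)) ('D_v ('D_u f)) => F G mixed key.
apply/eqP; rewrite -subr_eq0 -normr_le0; apply/ler_addgt0Pr => e e0; rewrite add0r.
have [|h [h0 hP]] := key (e / 2); first by rewrite divr_gt0.
have hD s r (sh : 0 <= s <= h) (rh : 0 <= r <= h) : D (x + s *: u + r *: v).
  by have [] := hP s r sh rh.
have [s [r [s' [r' [[sh rh] [sh' rh'] E]]]]] := mixed h h0 hD.
have [_ _ H1] := hP _ _ sh rh; have [_ H2 _] := hP _ _ sh' rh'.
rewrite E in H1.
exact: norm_split H2 H1.
Qed.

End Lines.

(** * The ring of smooth functions on an open set *)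

Section SmoothAlong.
Context {R : realType} {V : normedModType R} {I : Type} (e : I -> V).
Implicit Types (D : set V) (f g : V -> R).

(** Differentiability of order [k] along a family of directions. Letting the
    family vary makes the same theory serve space alone and space-time. *)
Fixpoint Cdir (k : nat) D f : Prop :=
  (forall x, D x -> {for x, continuous f}) /\
  (if k is k'.+1 then forall i,
     (forall x, D x -> derivable f x (e i)) /\ Cdir k' D ('D_(e i) f)
   else True).

Definition smooth_along D f : Prop := forall k, Cdir k D f.

Lemma Cdir_cont k D f : Cdir k D f -> forall x, D x -> {for x, continuous f}.
Proof. by case: k => [|k] []. Qed.

Lemma CdirW k D f : Cdir k.+1 D f -> Cdir k D f.
Proof.
elim: k f => [|k IHk] f [cf df]; first by split.
by split => // i; have [di ddi] := df i; split => //; exact: IHk.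
Qed.

Lemma near_open D (P : V -> Prop) x :
  open D -> D x -> (forall y, D y -> P y) -> \forall y \near x, P y.
Proof.
by move=> oD Dx DP; apply: filterS (open_nbhs_nbhs (conj oD Dx)).
Qed.

Lemma Cdir_ext k D f g : open D -> (forall x, D x -> f x = g x) ->
  Cdir k D f -> Cdir k D g.
Proof.
move=> oD; elim: k f g => [|k IHk] f g fg [cf df].
  split => // x Dx; move: (cf x Dx); rewrite /prop_for /continuous_at -fg//.
  apply: cvg_trans; apply: near_eq_cvg.
  by apply: near_open oD Dx _ => y Dy; rewrite fg.
have cg x : D x -> {for x, continuous g}.
  move=> Dx; move: (cf x Dx); rewrite /prop_for /continuous_at -fg//.
  apply: cvg_trans; apply: near_eq_cvg.
  by apply: near_open oD Dx _ => y Dy; rewrite fg.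
split=> // i; have [di ddi] := df i; split.
  move=> x Dx; apply: near_eq_derivable (di x Dx).
  exact: near_open oD Dx fg.
apply: IHk ddi => x Dx; apply: near_eq_derive.
exact: near_open oD Dx fg.
Qed.

Lemma Cdir_cst k D (c : R) : open D -> Cdir k D (cst c).
Proof.
move=> oD; elim: k c => [|k IHk] c.
  by split => // x _; exact: cst_continuous.
split; first by move=> x _; exact: cst_continuous.
move=> i; split; first by move=> x _; exact: derivable_cst.
by apply: Cdir_ext (IHk 0) => // x _; rewrite derive_cst.
Qed.

Lemma Cdir_add k D f g : open D -> Cdir k D f -> Cdir k D g -> Cdir k D (f + g).
Proof.
move=> oD; elim: k f g => [|k IHk] f g [cf df] [cg dg].
  by split => // x Dx; apply: continuousD; [exact: cf|exact: cg].
split; first by move=> x Dx; apply: continuousD; [exact: cf|exact: cg].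
move=> i; have [di ddi] := df i; have [ei ddei] := dg i; split.
  by move=> x Dx; apply: derivableD; [exact: di|exact: ei].
apply: Cdir_ext (IHk _ _ ddi ddei) => // x Dx.
by rewrite deriveD //; [exact: di|exact: ei].
Qed.

Lemma Cdir_mul k D f g : open D -> Cdir k D f -> Cdir k D g -> Cdir k D (f * g).
Proof.
move=> oD; elim: k f g => [|k IHk] f g Cf Cg.
  case: Cf Cg => cf _ [cg _].
  by split => // x Dx; apply: continuousM; [exact: cf|exact: cg].
have [Cfk Cgk] := (CdirW Cf, CdirW Cg).
case: Cf Cg => cf df [cg dg].
split; first by move=> x Dx; apply: continuousM; [exact: cf|exact: cg].
move=> i; have [di ddi] := df i; have [ei ddei] := dg i; split.
  by move=> x Dx; apply: derivableM; [exact: di|exact: ei].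
apply: Cdir_ext (Cdir_add oD (IHk _ _ Cfk ddei) (IHk _ _ Cgk ddi)) => // x Dx.
by rewrite deriveM //; [exact: di|exact: ei].
Qed.

Lemma Cdir_inv k D f : open D -> (forall x, D x -> f x != 0) ->
  Cdir k D f -> Cdir k D (fun x => (f x)^-1).
Proof.
move=> oD f0; elim: k => [|k IHk] Cf.
  by case: Cf => cf _; split => // x Dx; apply: cvgV; [exact: f0|exact: cf].
have Ck := IHk (CdirW Cf).
case: Cf => cf df.
split; first by move=> x Dx; apply: cvgV; [exact: f0|exact: cf].
move=> i; have [di ddi] := df i; split.
  by move=> x Dx; apply: derivableV; [exact: f0|exact: di].
have Cn := Cdir_mul oD (Cdir_cst k (-1) oD) (Cdir_mul oD (Cdir_mul oD Ck Ck) ddi).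
apply: Cdir_ext Cn => // x Dx.
rewrite deriveV; [|exact: f0|exact: di].
rewrite -mulr_algl /GRing.scale /= mulr1.
transitivity (-1 * ((f x)^-1 * (f x)^-1 * 'D_(e i) f x)) => //.
by rewrite expr2 invfM mulN1r mulNr.
Qed.

Lemma is_derive_along f x u (df : R) :
  is_derive x u f df <-> is_derive (0 : R) 1 (fun r : R => f (x + r *: u)) df.
Proof.
have E : (fun h : R => h^-1 *: (((fun r : R => f (x + r *: u)) \o shift 0) h%:A
      - f (x + 0 *: u))) =
    (fun h => h^-1 *: ((f \o shift x) (h *: u) - f x)).
  by apply/funext => h /=; rewrite addr0 [h%:A]mulr1 scale0r addr0 [x + _]addrC.
by split=> -[H1 H2]; split; move: H1 H2; rewrite /derivable /derive E.
Qed.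

Lemma is_derive_comp (h : R -> R) f x u (dh df : R) :
  is_derive (f x) 1 h dh -> is_derive x u f df -> is_derive x u (h \o f) (dh * df).
Proof.
move=> hd /is_derive_along fd; apply/is_derive_along.
apply: (is_derive1_comp (f := h)) => //.
by rewrite scale0r addr0.
Qed.

Lemma continuous_powR_comp f x a : 0 < f x -> {for x, continuous f} ->
  {for x, continuous (fun x => f x `^ a)}.
Proof.
move=> f0 cf; change {for x, continuous ((fun y => y `^ a) \o f)}.
apply: continuous_comp => //.
apply/differentiable_continuous/derivable1_diffP.
by have [] := is_derive1_powR a f0.
Qed.

(** The derivative of a power of [f] contains another power of [f], whence the
    induction with an arbitrary exponent. *)
Lemma Cdir_powR k D f a : open D -> (forall x, D x -> 0 < f x) ->
  Cdir k D f -> Cdir k D (fun x => f x `^ a).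
Proof.
move=> oD f0; elim: k a => [|k IHk] a Cf.
  case: Cf => cf _; split => // x Dx.
  by apply: continuous_powR_comp; [exact: f0|exact: cf].
have Ck b := IHk b (CdirW Cf).
case: Cf => cf df.
split.
  by move=> x Dx; apply: continuous_powR_comp; [exact: f0|exact: cf].
move=> i; have [di ddi] := df i.
have dp x : D x -> is_derive x (e i) (fun x => f x `^ a)
    (a * f x `^ (a - 1) * 'D_(e i) f x).
  by move=> Dx; have := is_derive_comp (is_derive1_powR a (f0 x Dx))
    (derivableP (di x Dx)).
split; first by move=> x /dp[].
have Cn := Cdir_mul oD (Cdir_mul oD (Cdir_cst k a oD) (Ck (a - 1))) ddi.
by apply: Cdir_ext Cn => // x /dp[_ ->].
Qed.

Lemma Cdir_schwarz k D f i j x : open D -> Cdir k.+2 D f -> D x ->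
  'D_(e i) ('D_(e j) f) x = 'D_(e j) ('D_(e i) f) x.
Proof.
move=> oD [_ df]; have [di [_ ddi]] := df i; have [dj [_ ddj]] := df j.
have [dij dijc] := ddi j; have [dji djic] := ddj i.
exact: (schwarz oD di dj dij dji (Cdir_cont dijc) (Cdir_cont djic)).
Qed.

End SmoothAlong.

Section SmoothRing.
Context {R : realType} {V : normedModType R} {I : Type} (e : I -> V).
Context {D : set V} (oD : open D).

(** The proof that [D] is open is a parameter so that the ring structure below,
    which depends on it, can be inferred from the type. *)
Definition smooth_on (_ : open D) (f : V -> R) : bool := `[< smooth_along e D f >].

Lemma smooth_on_subring : subring_closed (smooth_on oD).
Proof.
split=> [|f g /asboolP Cf /asboolP Cg|f g /asboolP Cf /asboolP Cg];
  apply/asboolP => k.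
- exact: (Cdir_cst e k 1 oD).
- apply: Cdir_add => //.
  rewrite -mulN1r; apply: Cdir_mul => //.
  exact: (Cdir_cst e k (-1) oD).
- exact: Cdir_mul.
Qed.

Record smooth_fct := SmoothFct {
  smooth_val :> V -> R; smooth_valP : smooth_val \in smooth_on oD }.

HB.instance Definition _ := [isSub for smooth_val].
HB.instance Definition _ := [Choice of smooth_fct by <:].
HB.instance Definition _ :=
  GRing.SubChoice_isSubComPzRing.Build (V -> R) (smooth_on oD) smooth_fct smooth_on_subring.

Implicit Types f g : smooth_fct.

Lemma smooth_fctP f : smooth_along e D f.
Proof. exact/asboolP/smooth_valP. Qed.

Lemma smooth_fct_eq f g : (forall x, f x = g x) -> f = g.
Proof. by move=> fg; apply: val_inj; apply/funext. Qed.

Definition ev (x : V) f : R := f x.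

Lemma ev_zmod_morphism x : zmod_morphism (ev x).
Proof. by move=> f g; rewrite /ev -[smooth_val (f - g)]/(val (f - g)) raddfB. Qed.

Lemma ev_monoid_morphism x : monoid_morphism (ev x).
Proof.
by split => [|f g]; rewrite /ev; [rewrite -[smooth_val 1]/(val _) rmorph1
  |rewrite -[smooth_val (f * g)]/(val (f * g)) rmorphM].
Qed.

HB.instance Definition _ x :=
  GRing.isZmodMorphism.Build smooth_fct R (ev x) (ev_zmod_morphism x).
HB.instance Definition _ x :=
  GRing.isMonoidMorphism.Build smooth_fct R (ev x) (ev_monoid_morphism x).

(** Elements of the ring are functions on the whole space, but only their
    values on [D] are meaningful; those outside are set to a constant so that
    identities on [D] become equalities of ring elements. *)
Definition glue (c : R) (h : V -> R) : V -> R :=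
  fun x => if `[< D x >] then h x else c.

Lemma glue_in c h x : D x -> glue c h x = h x.
Proof. by rewrite /glue => /asboolT ->. Qed.

Lemma glue_out c h x : ~ D x -> glue c h x = c.
Proof. by rewrite /glue => /asboolF ->. Qed.

Lemma glue_smooth c h : smooth_along e D h -> glue c h \in smooth_on oD.
Proof.
move=> Ch; apply/asboolP => k; apply: (Cdir_ext oD _ (Ch k)) => x Dx.
by rewrite glue_in.
Qed.

Definition mk_smooth c h (Ch : smooth_along e D h) : smooth_fct :=
  SmoothFct (glue_smooth c Ch).

Lemma smooth_along_derive i f : smooth_along e D ('D_(e i) f).
Proof. by move=> k; have [_ /(_ i)[]] := smooth_fctP f k.+1. Qed.

(** The derivative is set to 0 outside [D], where it would be meaningless. *)
Definition pder i f : smooth_fct := mk_smooth 0 (smooth_along_derive i f).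

Lemma pderE i f x : D x -> pder i f x = 'D_(e i) f x.
Proof. exact: glue_in. Qed.

Lemma pder_out i f x : ~ D x -> pder i f x = 0.
Proof. exact: glue_out. Qed.

Lemma derivable_smooth i f x : D x -> derivable f x (e i).
Proof. by move=> Dx; have [_ /(_ i)[/(_ x Dx)]] := smooth_fctP f 1. Qed.

Lemma evD x f g : (f + g) x = f x + g x. Proof. exact: (rmorphD (ev x)). Qed.
Lemma evM x f g : (f * g) x = f x * g x. Proof. exact: (rmorphM (ev x)). Qed.

Lemma pder_derivation i : derivation (pder i).
Proof.
split=> f g; apply: smooth_fct_eq => x; have [Dx|nDx] := pselect (D x).
- rewrite evD !pderE // -deriveD //; exact: derivable_smooth.
- by rewrite evD !pder_out // addr0.
- rewrite evD !evM !pderE//.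
  have := deriveM (@derivable_smooth i f x Dx) (@derivable_smooth i g x Dx).
  by rewrite addrC [_ * g x]mulrC => <-.
- by rewrite evD !evM !pder_out // mulr0 mul0r addr0.
Qed.

Lemma pderC i j f : pder i (pder j f) = pder j (pder i f).
Proof.
apply: smooth_fct_eq => x; have [Dx|nDx] := pselect (D x); last by rewrite !pder_out.
rewrite (@pderE i _ x Dx) (@pderE j _ x Dx).
have E a b : 'D_(e a) (pder b f) x = 'D_(e a) ('D_(e b) f) x.
  apply: near_eq_derive; apply: (near_open oD Dx) => y Dy; exact: pderE.
rewrite !E; exact: (Cdir_schwarz i j oD (smooth_fctP f 2) Dx).
Qed.

End SmoothRing.

(** * Functions of several coordinates *)

Lemma cvg_closer (R : realType) (V : normedModType R) (q : V -> V) (x : V) :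
  (forall y, `|q y - x| <= `|y - x|) -> q y @[y --> x] --> x.
Proof.
move=> qx; apply/cvgrPdist_lt => e e0.
have B : nbhs x (ball x e) by exact: nbhsx_ballx.
apply: filterS B => y; rewrite -ball_normE /ball_ /= distrC => yx.
by rewrite distrC (le_lt_trans (qx y)).
Qed.

Section Coordinates.
Context {R : realType} {n : nat}.
Implicit Types (f : 'rV[R]_n -> R) (x y v : 'rV[R]_n) (U : set 'rV[R]_n).

Definition axis (k : 'I_n) : 'rV[R]_n := delta_mx 0 k.

Lemma MVT_line_signed f x u (h : R) :
  (forall s, `|s| <= `|h| -> derivable f (x + s *: u) u) ->
  exists2 s, `|s| <= `|h| & f (x + h *: u) - f x = h * 'D_u f (x + s *: u).
Proof.
move=> df; have [h0|h0|h0] := ltgtP h 0.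
- have hN : 0 < - h by rewrite oppr_gt0.
  have E s : x + h *: u + s *: u = x + (h + s) *: u by rewrite -addrA -scalerDl.
  have [|s /andP[s0 sh]] := @MVT_line _ _ f (x + h *: u) u (- h) hN.
    move=> s /andP[s0 sh]; rewrite E; apply: df.
    by rewrite (ltr0_norm h0) ler_norml; apply/andP; split; lra.
  rewrite !E subrr scale0r addr0 => Ef; exists (h + s).
    by rewrite (ltr0_norm h0) ler_norml; apply/andP; split; lra.
  by rewrite -opprB Ef mulNr opprK.
- have [|s /andP[s0 sh] E] := @MVT_line _ _ f x u h h0.
    move=> s /andP[s0 sh]; apply: df.
    by rewrite !ger0_norm// ltW.
  by exists s => //; rewrite !ger0_norm ?ltW.
- by exists 0; rewrite h0 ?normr0// scale0r addr0 subrr mul0r.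
Qed.

(** The vertices of a path from [x] to [y] that moves along one coordinate axis
    at a time. *)
Definition staircase x y (j : nat) : 'rV[R]_n :=
  \row_k (if (k < j)%N then y 0 k else x 0 k).

Lemma staircase0 x y : staircase x y 0 = x.
Proof. by apply/rowP => k; rewrite mxE. Qed.

Lemma staircase_full x y : staircase x y n = y.
Proof. by apply/rowP => k; rewrite mxE ltn_ord. Qed.

Lemma staircaseS x y (j : 'I_n) :
  staircase x y j.+1 = staircase x y j + (y 0 j - x 0 j) *: axis j.
Proof.
apply/rowP => k; rewrite !mxE eqxx /= ltnS leq_eqVlt.
have [->|kj] := eqVneq k j; first by rewrite !eqxx ltnn /= mulr1 addrC subrK.
rewrite mulr0 addr0 /=.
by have /negbTE -> : nat_of_ord k != j by [].
Qed.

Lemma staircase_close x y (j : 'I_n) s : `|s| <= `|y 0 j - x 0 j| ->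
  `|staircase x y j + s *: axis j - x| <= `|y - x|.
Proof.
have coord_le (z : 'rV[R]_n) k : `|z 0 k| <= `|z|.
  rewrite [leRHS]/Num.Def.normr/= mx_normrE.
  by rewrite (le_trans _ (le_bigmax _ _ (0, k))).
move=> sj; rewrite [leLHS]/Num.Def.normr/= mx_normrE bigmax_le// => -[i k] _ /=.
rewrite ord1 !mxE eqxx /=; have [->|kj] := eqVneq k j.
  rewrite ltnn mulr1 addrAC subrr add0r (le_trans sj)//.
  by have := coord_le (y - x) j; rewrite !mxE.
rewrite mulr0 addr0; case: ifP => _; last by rewrite subrr normr0.
by have := coord_le (y - x) k; rewrite !mxE.
Qed.

(** Continuous partial derivatives give total differentiability, in the form of
    Caratheodory. The increment is split along [staircase] and each step is given
    by the mean value theorem; [G k y] is the partial derivative at the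
    intermediate point, which tends to [x] with [y] by [staircase_close]. *)
Lemma caratheodory U f x : open U -> U x ->
  (forall k y, U y -> derivable f y (axis k)) ->
  (forall k, {for x, continuous (partial k f)}) ->
  exists G : 'I_n -> 'rV[R]_n -> R,
    (forall k, G k y @[y --> x] --> partial k f x) /\
    \forall y \near x, f y - f x = \sum_k (y 0 k - x 0 k) * G k y.
Proof.
move=> oU Ux df cf.
have /nbhs_ballP[d /= d0 dU] := open_nbhs_nbhs (conj oU Ux).
have step y (k : 'I_n) : exists q : 'rV[R]_n, `|q - x| <= `|y - x| /\
    (`|y - x| < d -> f (staircase x y k.+1) - f (staircase x y k) =
      (y 0 k - x 0 k) * partial k f q).
  have [yd|yd] := ltP `|y - x| d; last by exists y.
  have [s sh|s sh E] := @MVT_line_signed f (staircase x y k) (axis k) (y 0 k - x 0 k).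
    apply: df; apply: dU; rewrite -ball_normE /ball_ /= distrC.
    by apply: le_lt_trans yd; exact: staircase_close.
  exists (staircase x y k + s *: axis k); split; first exact: staircase_close.
  by move=> _; rewrite staircaseS.
have {step} [q qP] := choice (fun yk : 'rV[R]_n * 'I_n => step yk.1 yk.2).
exists (fun k y => partial k f (q (y, k))); split.
  move=> k; apply: (cvg_comp (fun y => q (y, k)) (partial k f)); last exact: cf.
  by apply: cvg_closer => y; exact: (qP (y, k)).1.
have B : nbhs x (ball x d) by exact: nbhsx_ballx.
apply: filterS B => y; rewrite -ball_normE /ball_ /= distrC => yd.
rewrite -{1}(staircase_full x y) -{2}(staircase0 x y).
rewrite -(telescope_sumr (fun j => f (staircase x y j)))// big_mkord.
by apply: eq_bigr => k _; exact: (qP (y, k)).2.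
Qed.

(** The chain rule for curves: divide the identity of [caratheodory] along the
    curve by the increment of the parameter. *)
Lemma is_derive_curve U f x (g : R -> 'rV[R]_n) (c : 'I_n -> R) :
  open U -> U x ->
  (forall k y, U y -> derivable f y (axis k)) ->
  (forall k, {for x, continuous (partial k f)}) ->
  g 0 = x -> (forall k, is_derive (0 : R) 1 (fun s => g s 0 k) (c k)) ->
  is_derive (0 : R) 1 (f \o g) (\sum_k c k * partial k f x).
Proof.
move=> oU Ux df cf g0 dg.
have [G [Gc Gf]] := caratheodory oU Ux df cf.
have gc : g s @[s --> (0 : R)] --> x.
  rewrite -g0; apply/differentiable_continuous/derivable1_diffP/derivable_mxP.
  by move=> i j; rewrite ord1; have [] := dg j.
have gc' : g s @[s --> (0 : R)^'] --> x by apply: cvg_trans gc; exact: cvg_within_filter.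
have L : h^-1 *: ((f \o g) (h%:A + 0) - (f \o g) 0) @[h --> (0 : R)^'] -->
    \sum_k c k * partial k f x.
  apply: (@cvg_trans _ (\sum_k (h^-1 *: (g (h%:A + 0) 0 k - g 0 0 k)) * G k (g h)
     @[h --> (0 : R)^'])).
    apply: near_eq_cvg.
    have : \forall h \near (0 : R)^', f (g h) - f x =
      \sum_k (g h 0 k - x 0 k) * G k (g h) := gc' _ Gf.
    apply: filterS => h /= E; rewrite [h%:A]mulr1 addr0 g0 E /GRing.scale /= big_distrr /=.
    by apply: eq_bigr => k _; rewrite mulrA.
  apply: cvg_big => [|k _]; first exact: add_continuous.
  apply: cvgM; last exact: cvg_comp gc' (Gc k).
  by have [H1 <-] := dg k; exact: H1.
split; first by apply/cvg_ex; eexists; exact: L.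
exact: cvg_lim L.
Qed.

Lemma is_derive_axes U f x v : open U -> U x ->
  (forall k y, U y -> derivable f y (axis k)) ->
  (forall k, {for x, continuous (partial k f)}) ->
  is_derive x v f (\sum_k v 0 k * partial k f x).
Proof.
move=> oU Ux df cf; apply/is_derive_along.
apply: (is_derive_curve oU Ux df cf); first by rewrite scale0r addr0.
move=> k.
have -> : (fun s : R => (x + s *: v) 0 k) = cst (x 0 k) + (v 0 k) *: (id : R -> R).
  by apply/funext => s; rewrite !mxE mulrC.
have := is_deriveD (is_derive_cst (x 0 k) (0 : R) 1)
  (is_deriveZ (v 0 k) (is_derive_id (0 : R) 1)).
by rewrite add0r [_ *: 1]mulr1.
Qed.

Lemma Cdir_is_derive k U f x v : open U -> U x -> Cdir axis k.+1 U f ->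
  is_derive x v f (\sum_l v 0 l * partial l f x).
Proof.
move=> oU Ux [_ Cf]; apply: (is_derive_axes _ oU Ux) => l.
  by have [dl _] := Cf l.
by have [_ Cl] := Cf l; exact: (Cdir_cont Cl).
Qed.

End Coordinates.

Section LocalMinimum.
Context {R : realType}.

(** Were the second derivative negative, the first one, which vanishes at [x],
    would be negative just after [x], and by the mean value theorem so would be
    the increments of [F]. *)
Lemma min_along_line (V : normedModType R) (U : set V) (F : V -> R) x xi :
  open U -> U x -> (forall y, U y -> F x <= F y) ->
  (forall y, U y -> derivable F y xi) -> derivable ('D_xi F) x xi ->
  'D_xi F x = 0 /\ 0 <= 'D_xi ('D_xi F) x.
Proof.
move=> oU Ux Fmin dF ddF.
have [h [h0 hU]] : exists h : R, [/\ 0 < h & forall s, `|s| <= h -> U (x + s *: xi)].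
  have /nbhs_ballP[d /= d0 dU] := open_nbhs_nbhs (conj oU Ux).
  have xi0 : 0 < `|xi| + 1 by rewrite ltr_wpDl.
  (* [xi] may vanish *)
  exists (d / (`|xi| + 1)); split; first by rewrite divr_gt0.
  move=> s sh; apply: dU; rewrite -ball_normE /ball_ /= opprD addNKr normrN normrZ.
  apply: (@le_lt_trans _ _ (d / (`|xi| + 1) * `|xi|)); first by rewrite ler_wpM2r.
  by rewrite mulrAC ltr_pdivrMr// ltr_pM2l// ltrDl.
have D0 : 'D_xi F x = 0.
  have : is_derive (0 : R) 1 (fun s : R => F (x + s *: xi)) 0.
    apply: (@derive1_at_min _ _ (- h) h).
    - by rewrite ge0_cp// ltW.
    - move=> t; rewrite in_itv /= => /andP[t1 t2].
      have th : `|t| <= h by rewrite ler_norml !ltW.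
      by have [] := is_derive_line (dF _ (hU t th)).
    - by rewrite in_itv /= oppr_lt0 h0.
    - move=> t; rewrite in_itv /= => /andP[t1 t2].
      rewrite scale0r addr0; apply/Fmin/hU.
      by rewrite ler_norml !ltW.
  by move/(@is_derive_along _ _ F x xi 0) => -[_ ->].
split=> //; rewrite leNgt; apply/negP => q0.
have Q : h^-1 *: (('D_xi F \o shift x) (h *: xi) - 'D_xi F x) @[h --> (0 : R)^'] -->
   'D_xi ('D_xi F) x by exact: ddF.
have : \forall r \near (0 : R)^', r^-1 * 'D_xi F (x + r *: xi) < 0.
  have Q' : \forall r \near (0 : R)^',
    r^-1 *: (('D_xi F \o shift x) (r *: xi) - 'D_xi F x) < 0.
    exact: (cvgr_lt _ Q).
  move: Q'; apply: filterS => r.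
  by rewrite D0 subr0 /= [_ + x]addrC.
rewrite near_withinE => -[d /= d0 dP].
pose r := Num.min h (d / 2).
have r0 : 0 < r by rewrite lt_min h0 divr_gt0.
have rh : r <= h by rewrite ge_min lexx.
have rd : r < d by rewrite gt_min ltr_pdivrMr// ltr_pMr// ltr1n orbT.
have [|s /andP[s0 sr] E] := @MVT_line _ _ F x xi r r0.
  by move=> s /andP[s0 sr]; apply/dF/hU; rewrite ger0_norm// (le_trans sr).
have /dP /(_ (lt0r_neq0 s0)) : ball (0 : R) d s.
  by rewrite /ball /= sub0r normrN gtr0_norm// (lt_trans sr).
rewrite pmulr_rlt0 ?invr_gt0// => Ds.
have : 0 <= r * 'D_xi F (x + s *: xi).
  by rewrite -E subr_ge0; apply/Fmin/hU; rewrite gtr0_norm.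
by rewrite pmulr_rge0// leNgt Ds.
Qed.

Lemma second_order_minimum n (U : set 'rV[R]_n) (F : 'rV[R]_n -> R) x :
  open U -> U x -> Cdir axis 2 U F -> (forall y, U y -> F x <= F y) ->
  (forall k, partial k F x = 0) /\
  forall xi : 'rV[R]_n,
    0 <= \sum_k \sum_l xi 0 k * xi 0 l * partial l (partial k F) x.
Proof.
move=> oU Ux CF Fmin.
have DF y xi : U y -> is_derive y xi F (\sum_l xi 0 l * partial l F y).
  by move=> Uy; exact: (Cdir_is_derive _ oU Uy CF).
have DDF xi : is_derive x xi ('D_xi F)
    (\sum_k \sum_l xi 0 k * xi 0 l * partial l (partial k F) x).
  apply: (@near_eq_is_derive _ _ _ (\sum_k (xi 0 k *: partial k F))).
    apply: (near_open oU Ux) => y Uy; have [_ ->] := DF y xi Uy.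
    by rewrite fct_sumE.
  apply: is_derive_sum => k.
  have Dk : is_derive x xi (partial k F) (\sum_l xi 0 l * partial l (partial k F) x).
    by have [_ /(_ k)[_ Ck1]] := CF; exact: (@Cdir_is_derive _ _ 0 U (partial k F) x xi oU Ux Ck1).
  apply: is_derive_eq; rewrite /GRing.scale /= big_distrr /=.
  by apply: eq_bigr => l _; rewrite mulrA.
have main xi := min_along_line oU Ux Fmin (fun y Uy => @ex_derive _ _ _ _ _ _ _ (DF y xi Uy))
    (@ex_derive _ _ _ _ _ _ _ (DDF xi)).
split=> [k|xi]; first by have [] := main (axis k).
by have [_] := main xi; have [_ ->] := DDF xi.
Qed.

End LocalMinimum.

(** * Changes of charts *)

Section Charts.
Context {R : realType} {n : nat} {M : topologicalType}.
Context {A : smooth_manifold R n M} (G : riemannian_metric A).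

Lemma im_coord (i : chart A) p : dom A i p -> im i (coord A i p).
Proof. by move=> ip; exists p. Qed.

Lemma im_param (i : chart A) x : im i x ->
  dom A i (param A i x) /\ coord A i (param A i x) = x.
Proof. by move=> [p ip <-]; rewrite coordK. Qed.

Lemma open_im (i : chart A) : open (im i). Proof. exact: im_open. Qed.

(** The expression of [f] in one chart is its expression in the other one composed
    with the transition map, to which [is_derive_curve] applies along the
    coordinate lines. *)
Lemma partial_change_chart (i j : chart A) (f : M -> R) p a :
  dom A i p -> dom A j p -> Cdir axis 1 (im j) (in_chart j f) ->
  partial a (in_chart i f) (coord A i p) =
  \sum_c transition_jacobian i j (coord A i p) a c
    * partial c (in_chart j f) (coord A j p).
Proof.
move=> ip jp Cf; set x := coord A i p.
pose phi y := coord A j (param A i y).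
have near_j : \forall y \near x, dom A j (param A i y).
  have ix : im i x := im_coord ip.
  have N : nbhs (param A i x) (dom A j).
    by apply: open_nbhs_nbhs; split; [exact: dom_open|rewrite /x coordK].
  exact: (param_continuous ix N).
have fphi : \forall y \near x, in_chart i f y = (in_chart j f \o phi) y.
  by apply: filterS near_j => y jy; rewrite /in_chart /phi /= coordK.
have xij : (coord A i @` (dom A i `&` dom A j)) x by exists p.
have dphi c : is_derive (0 : R) 1 (fun s : R => phi (x + s *: axis a) 0 c)
    (transition_jacobian i j x a c).
  apply: (@is_derive_along _ _ (fun y => phi y 0 c) x (axis a) _).1.
  rewrite mxE; apply/derivableP.
  by have [_ /(_ a)[/(_ x xij)]] := transition_smooth i j c 1.
rewrite {1}/partial (near_eq_derive _ fphi).
have phi0 : phi (x + 0 *: axis a) = coord A j p by rewrite scale0r addr0 /phi coordK.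
have H : is_derive (0 : R) 1 (in_chart j f \o (fun s : R => phi (x + s *: axis a)))
    (\sum_c transition_jacobian i j x a c * partial c (in_chart j f) (coord A j p)).
  apply: (is_derive_curve (open_im (i := j)) (im_coord jp)) => //.
  - by move=> k y jy; have [_ /(_ k)[/(_ y jy)]] := Cf.
  - by move=> k; have [_ /(_ k)[_ [Ck _]]] := Cf; exact/Ck/im_coord.
by have [_ ->] := (@is_derive_along _ _ (in_chart j f \o phi) x (axis a) _).2 H.
Qed.

(** The differential is multiplied by the transition Jacobian, the cometric by
    its inverse on both sides. *)
Lemma grad_dot_change_chart (i j : chart A) (f : M -> R) p :
  dom A i p -> dom A j p -> Cdir axis 1 (im j) (in_chart j f) ->
  grad_dot G i f f p = grad_dot G j f f p.
Proof.
move=> ip jp Cf; rewrite /grad_dot /cometric.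
have := met_transition G ip jp; set J := transition_jacobian i j _ => /= met_ij.
set x := coord A i p; set y := coord A j p.
have dij : differential i f x = differential j f y *m J^T.
  apply/rowP => a; rewrite !mxE (partial_change_chart a ip jp Cf).
  by apply: eq_bigr => c _; rewrite !mxE mulrC.
have iu : met G i x \in unitmx by apply: posdef_unit; exact/met_pos/im_coord.
have ju : met G j y \in unitmx by apply: posdef_unit; exact/met_pos/im_coord.
have Ju : J \in unitmx by move: iu; rewrite met_ij !unitmx_mul => /andP[/andP[]].
have JTu : J^T \in unitmx by rewrite unitmx_tr.
have E : J^T *m invmx (met G i x) *m J = invmx (met G j y).
  have H : J^T *m invmx (met G i x) *m J *m met G j y = 1%:M.
    have Jg : J *m met G j y = met G i x *m invmx J^T.
      by rewrite met_ij -!mulmxA mulmxV// mulmx1.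
    by rewrite -!mulmxA Jg mulKmx; [exact: mulmxV|exact: iu].
  by rewrite -[RHS]mul1mx -H mulmxK.
by rewrite dij trmx_mul trmxK -!mulmxA (mulmxA (invmx _)) (mulmxA J^T) (mulmxA J^T) E.
Qed.

End Charts.

(** * Space-time functions on a cylinder *)

Section TimeDerivative.
Context {R : realType}.
Implicit Types (J : set R) (f : R -> R) (t : R).

(** At an interior time the restriction to [J] of the difference quotient is
    harmless, and the quotient is the usual one up to a translation. *)
Lemma time_filter_interior J f t : nbhs t J ->
  (time_quotient f t @ within J (dnbhs t)) =
  ((fun h : R => h^-1 *: ((f \o shift t) (h *: (1 : R)) - f t)) @ (0 : R)^').
Proof.
move=> Jt; rewrite predeqE => B.
have E (h : R) : h^-1 *: ((f \o shift t) (h *: (1 : R)) - f t) = time_quotient f t (h + t).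
  by rewrite /time_quotient /= [h *: 1]mulr1 addrK.
have -> : ((fun h : R => h^-1 *: ((f \o shift t) (h *: (1 : R)) - f t)) @ (0 : R)^') B =
    (\forall h \near (0 : R), h + t != t -> B (time_quotient f t (h + t))).
  change ((\forall h \near (0 : R), h != 0 ->
     B (h^-1 *: ((f \o shift t) (h *: (1 : R)) - f t))) =
    (\forall h \near (0 : R), h + t != t -> B (time_quotient f t (h + t)))).
  apply/propext; split; apply: filterS => h /= H h0.
    by rewrite -E; apply: H; apply: contra_neq h0 => ->; rewrite add0r.
  by rewrite E; apply: H; apply: contra_neq h0 => /eqP; rewrite -subr_eq0 addrK => /eqP.
have -> : (\forall h \near (0 : R), h + t != t -> B (time_quotient f t (h + t))) =
    (\forall s \near t, s != t -> B (time_quotient f t s)).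
  by rewrite [RHS](near_shift 0) subr0.
split; rewrite /fmap /= /within /=.
  by apply: filterS2 Jt => s Js Hs st; exact: Hs.
by apply: filterS => s Hs st _; exact: Hs.
Qed.

Lemma dtime_interior J f t : nbhs t J -> dtime J f t = 'D_1 f t.
Proof. by move=> Jt; rewrite /dtime time_filter_interior. Qed.

Lemma time_derivable_interior J f t : nbhs t J ->
  time_derivable J f t -> derivable f t 1.
Proof. by move=> Jt; rewrite /time_derivable time_filter_interior. Qed.

(** Stated for an arbitrary filter at [t], so as to cover one-sided derivatives. *)
Lemma cvg_quotient_comp (F : set_system R) (FF : ProperFilter F) f t (l dh : R) (h : R -> R) :
  s @[s --> F] --> t -> (\forall s \near F, s != t) ->
  time_quotient f t @ F --> l -> is_derive (f t) 1 h dh ->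
  time_quotient (h \o f) t @ F --> dh * l.
Proof.
move=> Ft neq fl /is_derive1_caratheodory[g [hg gc ge]].
have st : (s - t) @[s --> F] --> (0 : R).
  by rewrite -(subrr t); apply: cvgB Ft _; exact: cvg_cst.
have fF : f s @[s --> F] --> f t.
  have L : (s - t) * time_quotient f t s + f t @[s --> F] --> f t.
    rewrite -[X in _ --> X]add0r -[X in _ --> X + _](mul0r l).
    by apply: cvgD; [exact: cvgM st fl|exact: cvg_cst].
  apply: cvg_trans L; apply: near_eq_cvg; apply: filterS neq => s sn.
  by rewrite /time_quotient mulVKf ?subr_eq0// subrK.
have L : g (f s) * time_quotient f t s @[s --> F] --> dh * l.
  by apply: cvgM fl; rewrite -ge; apply: cvg_comp fF gc.
apply: cvg_trans L; apply: near_eq_cvg; apply: filterS neq => s sn.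
by rewrite /time_quotient /= hg mulrCA.
Qed.

Lemma dtime_comp J (h : R -> R) f t dh : ProperFilter (within J (dnbhs t)) ->
  is_derive (f t) 1 h dh -> time_derivable J f t ->
  dtime J (h \o f) t = dh * dtime J f t.
Proof.
move=> PF hd fd; apply: cvg_lim => //.
apply: cvg_quotient_comp hd => //; last first.
  by rewrite /within /=; apply: filterS (nbhs_dnbhs_neq t) => s.
move=> B Bt; rewrite /within /= /dnbhs /within /=.
by apply: filterS Bt.
Qed.

End TimeDerivative.

Section SpaceTime.
Context {R : realType} {n : nat} (T : R) (U : set 'rV[R]_n).

Definition spacetime_axis (i : option 'I_n) : R * 'rV[R]_n :=
  if i is Some k then (0, axis k) else (1, 0).

Definition cylinder : set (R * 'rV[R]_n) := [set z | 0 < z.1 < T /\ U z.2].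

Lemma open_cylinder : open U -> open cylinder.
Proof.
move=> oU.
have -> : cylinder = (fst @^-1` `]0, T[ : set (R * 'rV[R]_n)) `&` (snd @^-1` U).
  by apply/seteqP; split=> z /=; rewrite in_itv.
apply: openI.
  by apply: open_comp => [z _|]; [exact: cvg_fst|exact: interval_open].
by apply: open_comp => [z _|//]; exact: cvg_snd.
Qed.

Lemma is_derive_time (F : R * 'rV[R]_n -> R) (z : R * 'rV[R]_n) (d : R) :
  is_derive z.1 1 (fun t => F (t, z.2)) d <-> is_derive z (spacetime_axis None) F d.
Proof.
have E : (fun h : R => h^-1 *: (((fun t => F (t, z.2)) \o shift z.1) h%:A - F (z.1, z.2)))
    = (fun h : R => h^-1 *: ((F \o shift z) (h *: spacetime_axis None) - F z)).
  apply/funext => h /=; rewrite -surjective_pairing; congr (_ *: (F _ - _)).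
  by apply/pair_eqP; rewrite /pair_eq /= scaler0 add0r !eqxx.
by split=> -[H1 H2]; split; move: H1 H2; rewrite /derivable /derive E.
Qed.

Lemma is_derive_space (F : R * 'rV[R]_n -> R) (z : R * 'rV[R]_n) k (d : R) :
  is_derive z.2 (axis k) (fun x => F (z.1, x)) d <->
  is_derive z (spacetime_axis (Some k)) F d.
Proof.
have E : (fun h : R => h^-1 *: (((fun x => F (z.1, x)) \o shift z.2) (h *: axis k) - F (z.1, z.2)))
    = (fun h : R => h^-1 *: ((F \o shift z) (h *: spacetime_axis (Some k)) - F z)).
  apply/funext => h /=; rewrite -surjective_pairing; congr (_ *: (F _ - _)).
  by apply/pair_eqP; rewrite /pair_eq /= scaler0 add0r !eqxx.
by split=> -[H1 H2]; split; move: H1 H2; rewrite /derivable /derive E.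
Qed.

(** On the open cylinder the one-sided time derivatives are two-sided, so that
    all derivatives, in time and in space, are directional derivatives in the
    product space. *)
Lemma Ck_spacetime_Cdir k (w : R -> 'rV[R]_n -> R) : open U ->
  Ck_spacetime k `]0, T] U w -> Cdir spacetime_axis k cylinder (fun z => w z.1 z.2).
Proof.
move=> oU; have oD := open_cylinder oU.
have inJ t : 0 < t < T -> nbhs t [set` `]0, T]] /\ [set` `]0, T]] t.
  move=> tT; split; last by rewrite /= in_itv /=; case/andP: tT => -> /ltW ->.
  have H : nbhs t [set` `]0, T[].
    by apply: open_nbhs_nbhs; split; [exact: interval_open|rewrite /= in_itv].
  by apply: filterS H => s /=; rewrite !in_itv /= => /andP[-> /ltW ->].
have cont (v : R -> 'rV[R]_n -> R) :
    {within `]0, T] `*` U, continuous (fun z : R * 'rV[R]_n => v z.1 z.2)} ->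
    forall z, cylinder z -> {for z, continuous (fun z => v z.1 z.2)}.
  move=> cv z Dz.
  have {}cv : {within cylinder, continuous (fun z : R * 'rV[R]_n => v z.1 z.2)}.
    apply: continuous_subspaceW cv => -[t x] /= [tT Ux]; split => //=.
    by have [] := inJ t tT.
  by move: cv; rewrite continuous_open_subspace// => /(_ z (mem_set Dz)).
elim: k w => [|k IHk] w; first by case=> cw _; split => //; exact: cont.
case=> cw [[dt Cdt] dx]; split; first exact: cont.
case=> [l|].
  have [dl Cl] := dx l.
  have dw z : cylinder z -> is_derive z (spacetime_axis (Some l)) (fun z => w z.1 z.2)
      (partial l (w z.1) z.2).
    move=> [/inJ[_ zT] Uz]; apply/is_derive_space => /=.
    exact/derivableP/(dl _ _ zT Uz).
  split; first by move=> z /dw[].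
  by apply: (Cdir_ext oD _ (IHk _ Cl)) => z /dw[_ ->].
have dw z : cylinder z -> is_derive z (spacetime_axis None) (fun z => w z.1 z.2)
    (dtime `]0, T] (w^~ z.2) z.1).
  move=> [/inJ[zJ zT] Uz]; apply/is_derive_time => /=.
  rewrite dtime_interior//; apply: derivableP.
  exact: time_derivable_interior zJ (dt _ _ zT Uz).
split; first by move=> z /dw[].
by apply: (Cdir_ext oD _ (IHk _ Cdt)) => z /dw[_ ->].
Qed.

(** A function of space only has a vanishing time derivative. *)
Lemma static_Cdir k (h : 'rV[R]_n -> R) : open U -> Ck k U h ->
  Cdir spacetime_axis k cylinder (fun z => h z.2).
Proof.
move=> oU; have oD := open_cylinder oU.
have cont (g : 'rV[R]_n -> R) : (forall x, U x -> {for x, continuous g}) ->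
    forall z, cylinder z -> {for z, continuous (fun z : R * 'rV[R]_n => g z.2)}.
  move=> cg z [_ Uz].
  change {for z, continuous (g \o snd)}; apply: continuous_comp; last exact: cg.
  exact: cvg_snd.
elim: k h => [|k IHk] h; first by case=> ch _; split => //; exact: cont.
case=> ch dh; split; first exact: cont.
case=> [l|].
  have [dl Cl] := dh l.
  have dw z : cylinder z -> is_derive z (spacetime_axis (Some l)) (fun z => h z.2)
      (partial l h z.2).
    by move=> [_ Uz]; apply/is_derive_space/derivableP/(dl _ Uz).
  split; first by move=> z /dw[].
  by apply: (Cdir_ext oD _ (IHk _ Cl)) => z /dw[_ ->].
have dw z : cylinder z -> is_derive z (spacetime_axis None) (fun z => h z.2) 0.
  by move=> _; apply/is_derive_time; exact: (is_derive_cst (h z.2) z.1 (1 : R)).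
split; first by move=> z /dw[].
by apply: (Cdir_ext oD _ (Cdir_cst spacetime_axis k 0 oD)) => z /dw[_ ->].
Qed.

End SpaceTime.

(** * The porous medium equation in the ring of a chart *)

Section SmoothElements.
Context {R : realType} {V : normedModType R} {I : Type} (e : I -> V).
Context {D : set V} (oD : open D).
Local Notation S := (smooth_fct e oD).

Lemma const_smooth (c : R) : cst c \in smooth_on e oD.
Proof. by apply/asboolP => k; exact: Cdir_cst. Qed.

Definition const (c : R) : S := SmoothFct (const_smooth c).

Lemma pder_const j c : pder j (const c) = 0.
Proof.
apply: smooth_fct_eq => x; have [Dx|nDx] := pselect (D x); last by rewrite pder_out.
rewrite (pderE _ _ Dx).
exact: (@derive_cst _ _ _ c x (e j)).
Qed.

Lemma inv_smooth (f : S) : (forall x, f x != 0) ->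
  (fun x => (f x)^-1) \in smooth_on e oD.
Proof.
by move=> f0; apply/asboolP => k; apply: Cdir_inv => //; exact: smooth_fctP.
Qed.

Lemma pow_smooth (f : S) a : (forall x, 0 < f x) ->
  (fun x => f x `^ a) \in smooth_on e oD.
Proof.
by move=> f0; apply/asboolP => k; apply: Cdir_powR => //; exact: smooth_fctP.
Qed.

Definition pow (f : S) (f0 : forall x, 0 < f x) a : S := SmoothFct (pow_smooth a f0).

Lemma pder_pow j (f : S) (f0 : forall x, 0 < f x) a :
  pder j (pow f0 a) = const a * pow f0 (a - 1) * pder j f.
Proof.
apply: smooth_fct_eq => x; rewrite !evM.
have [Dx|nDx] := pselect (D x); last by rewrite !pder_out// mulr0.
rewrite (pderE _ _ Dx) (pderE _ f Dx).
by have [_ ->] := is_derive_comp (is_derive1_powR a (f0 x))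
   (derivableP (@derivable_smooth _ _ _ _ _ oD j f x Dx)).
Qed.

End SmoothElements.

Section ChartRing.
Context {R : realType} {n : nat} {M : topologicalType}.
Context {A : smooth_manifold R n M} (G : riemannian_metric A) (i : chart A) (T : R).

Let oU : open (im i) := open_im (i := i).
Let oD := open_cylinder (T := T) oU.
Local Notation S := (smooth_fct spacetime_axis oD).
Local Notation dx := (fun a : 'I_n => pder (oD := oD) (Some a)).
Local Notation dt := (pder (oD := oD) None).

Let der j : derivation (pder (e := spacetime_axis) (oD := oD) j) := @pder_derivation _ _ _ spacetime_axis _ oD j.

Definition static c (h : 'rV[R]_n -> R) (hs : smooth (im i) h) : S :=
  mk_smooth oD c (fun k => static_Cdir T oU (hs k)).

Lemma dt_static c h (hs : smooth (im i) h) : dt (static c hs) = 0.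
Proof.
apply: smooth_fct_eq => z; have [Dz|nDz] := pselect (cylinder T (im i) z); last first.
  by rewrite pder_out.
rewrite (pderE _ _ Dz); transitivity ('D_(spacetime_axis None) (fun z => h z.2) z).
  by apply: near_eq_derive; apply: (near_open oD Dz) => y; exact: glue_in.
have H : is_derive z (spacetime_axis None) (fun z : R * 'rV[R]_n => h z.2) 0.
  by apply/is_derive_time; exact: (is_derive_cst (h z.2) z.1 (1 : R)).
by have [_ ->] := H.
Qed.

(** Elements of the ring of the chart [i] carry the suffix [S]. Outside the
    cylinder the metric is replaced by the identity, so that it is invertible
    everywhere. *)
Definition metS : 'M[S]_n := \matrix_(a, b) static (a == b)%:R (met_smooth G i a b).

Lemma metS_in t x : 0 < t < T -> im i x -> map_mx (ev (t, x)) metS = met G i x.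
Proof. by move=> tT Ux; apply/matrixP => a b; rewrite !mxE /ev /= glue_in. Qed.

Lemma metS_out z : ~ cylinder T (im i) z -> map_mx (ev z) metS = 1%:M.
Proof. by move=> nz; apply/matrixP => a b; rewrite !mxE /ev /= glue_out. Qed.

Lemma metST : metS^T = metS.
Proof.
apply/matrixP => a b; rewrite !mxE; apply: smooth_fct_eq => -[t x].
have [[tT Ux]|nz] := pselect (cylinder T (im i) (t, x)).
  rewrite /= !glue_in//=; have /matrixP/(_ a b) := met_sym G Ux.
  by rewrite mxE.
by rewrite /= !glue_out// eq_sym.
Qed.

Lemma det_metS_neq0 z : (\det metS : S) z != 0.
Proof.
rewrite -[_ z]/(ev z (\det metS)) -det_map_mx.
case: z => t x; have [[tT Ux]|nz] := pselect (cylinder T (im i) (t, x)).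
  have : met G i x \in unitmx by apply: posdef_unit => xi; exact: met_pos.
  by rewrite metS_in// unitmxE unitfE.
by rewrite metS_out// det1 oner_neq0.
Qed.

(** Cramer's formula shows that the inverse metric is smooth. *)
Definition cometS : 'M[S]_n :=
  (SmoothFct (inv_smooth det_metS_neq0) : S) *: \adj metS.

Lemma metS_cometS : metS *m cometS = 1%:M.
Proof.
rewrite /cometS -scalemxAr mul_mx_adj scale_scalar_mx; congr (_ %:M).
by apply: smooth_fct_eq => z; rewrite evM /= mulVf// det_metS_neq0.
Qed.

Lemma cometST : cometS^T = cometS.
Proof. by rewrite /cometS linearZ /= trmx_adj metST. Qed.

Lemma cometS_in t x : 0 < t < T -> im i x -> map_mx (ev (t, x)) cometS = cometric G i x.
Proof.
move=> tT Ux; have gu : met G i x \in unitmx.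
  by apply: posdef_unit => xi; exact: met_pos.
rewrite -[LHS]mul1mx -(mulVmx gu) -mulmxA -(metS_in tT Ux) -map_mxM metS_cometS.
by rewrite map_mx1 mulmx1 (metS_in tT Ux).
Qed.

Lemma dt_metS a b : dt (metS a b) = 0. Proof. by rewrite mxE dt_static. Qed.

(** Differentiate the product of the metric and its inverse. *)
Lemma dt_cometS a b : dt (cometS a b) = 0.
Proof.
have Dg : map_mx dt metS = 0 by apply/matrixP => p q; rewrite mxE dt_metS mxE.
have := derivation_mxM (der None) metS cometS.
rewrite metS_cometS (derivation_mx1 (der None)) Dg mul0mx add0r => E.
have : map_mx dt cometS = 0.
  by rewrite -[LHS]mul1mx -(Ag metST cometST metS_cometS) -mulmxA -E mulmx0.
by move/matrixP/(_ a b); rewrite !mxE.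
Qed.

Definition halfS : S := const spacetime_axis oD 2^-1.

Lemma halfSP : halfS + halfS = 1.
Proof.
by apply: smooth_fct_eq => z; rewrite evD /=; rewrite -[RHS]/((1 : R)); field.
Qed.

(** The element [f] has the coordinate expression [h] at time [t]. As this is
    stable under space derivatives, all objects built from the metric evaluate to
    their geometric counterparts. *)
Definition at_time t (f : S) (h : 'rV[R]_n -> R) : Prop :=
  forall x, im i x -> f (t, x) = h x.

Lemma ev_entry z (X : 'M[S]_1) : ev z (X 0 0) = map_mx (ev z) X 0 0.
Proof. by rewrite [RHS]mxE. Qed.

Section AtTime.
Variables (t : R) (tT : 0 < t < T).

(** The image of the chart is open, so the derivative in space only sees values
    at the time [t]. *)
Lemma at_time_dx f h a : at_time t f h -> at_time t (dx a f) (partial a h).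
Proof.
move=> fh x Ux; have Dz : cylinder T (im i) (t, x) by [].
rewrite (pderE _ _ Dz) /partial.
have := derivableP (@derivable_smooth _ _ _ _ _ oD (Some a) f _ Dz).
move/is_derive_space => /= -[_ <-].
apply: near_eq_derive; apply: (near_open oU Ux) => y Uy; exact: fh.
Qed.

Lemma at_time_chris c a b :
  at_time t (chris dx halfS metS cometS c a b) (christoffel G i c a b).
Proof.
move=> x Ux; rewrite -[LHS]/(ev (t, x) _) rmorphM rmorph_sum /christoffel.
congr (_ * _); apply: eq_bigr => e _; rewrite rmorphM rmorphB rmorphD.
have -> : cometric G i x c e = ev (t, x) (cometS c e).
  by rewrite -(cometS_in tT Ux) [LHS]mxE.
congr (_ * _).
have E p q : at_time t (metS p q) (fun y => met G i y p q).
  by move=> y Uy; rewrite -(metS_in tT Uy) [RHS]mxE.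
by congr (_ + _ - _); exact: (at_time_dx _ (E _ _) Ux).
Qed.

Lemma at_time_riem e c a b :
  at_time t (riem dx halfS metS cometS e c a b) (riemann G i e c a b).
Proof.
move=> x Ux; rewrite -[LHS]/(ev (t, x) _) rmorphD rmorphB rmorph_sum /riemann.
congr (_ - _ + _); [exact: (at_time_dx _ (at_time_chris _ _ _) Ux) | exact: (at_time_dx _ (at_time_chris _ _ _) Ux) |].
apply: eq_bigr => h _; rewrite rmorphB; congr (_ - _); rewrite rmorphM.
  by congr (_ * _); exact: at_time_chris.
by congr (_ * _); exact: at_time_chris.
Qed.

Lemma at_time_ric x : im i x ->
  map_mx (ev (t, x)) (ric dx halfS metS cometS) = ricci G i x.
Proof.
move=> Ux; apply/matrixP => b c; rewrite !mxE rmorph_sum.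
by apply: eq_bigr => a _; exact: at_time_riem.
Qed.

Lemma at_time_gradient f (h : M -> R) x : im i x -> at_time t f (in_chart i h) ->
  map_mx (ev (t, x)) (gradient dx f) = (differential i h x)^T.
Proof.
move=> Ux fh; apply/matrixP => a j; by rewrite !mxE; exact: (at_time_dx _ fh Ux).
Qed.

Lemma at_time_hess f (h : M -> R) x : im i x -> at_time t f (in_chart i h) ->
  map_mx (ev (t, x)) (hess dx halfS metS cometS f) = hessian G i h x.
Proof.
move=> Ux fh; apply/matrixP => a b; rewrite !mxE rmorphB rmorph_sum.
congr (_ - _); first exact: (at_time_dx _ (at_time_dx _ fh) Ux).
apply: eq_bigr => c _; rewrite rmorphM; congr (_ * _).
  exact: at_time_chris.
exact: (at_time_dx _ fh Ux).
Qed.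

Lemma at_time_dot f h (F H : M -> R) p : dom A i p ->
  at_time t f (in_chart i F) -> at_time t h (in_chart i H) ->
  dot dx cometS f h (t, coord A i p) = grad_dot G i F H p.
Proof.
move=> ip fF hH; have Ux := im_coord ip.
rewrite -[LHS]/(ev _ _) /dot ev_entry !map_mxM -map_trmx.
by rewrite (at_time_gradient Ux fF) (at_time_gradient Ux hH) cometS_in// trmxK.
Qed.

Lemma at_time_lap f (F : M -> R) p : dom A i p -> at_time t f (in_chart i F) ->
  lap dx halfS metS cometS f (t, coord A i p) = laplacian G i F p.
Proof.
move=> ip fF; have Ux := im_coord ip.
rewrite -[LHS]/(ev _ _) /lap -trace_map_mx map_mxM.
by rewrite (at_time_hess Ux fF) cometS_in.
Qed.

Lemma at_time_wlap fpsi psi f (F : M -> R) p : dom A i p ->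
  at_time t fpsi (in_chart i psi) -> at_time t f (in_chart i F) ->
  wlap dx halfS metS cometS fpsi f (t, coord A i p) = weighted_laplacian G psi i F p.
Proof.
move=> ip fpsiE fF; rewrite -[LHS]/(ev _ _) /wlap rmorphB /weighted_laplacian.
by congr (_ - _); [exact: at_time_lap | exact: at_time_dot].
Qed.

End AtTime.

(** All derivatives vanish outside the cylinder. *)
Lemma wlap_out fpsi f z : ~ cylinder T (im i) z ->
  wlap dx halfS metS cometS fpsi f z = 0.
Proof.
move=> nz; have d0 a h : ev z (dx a h) = 0 by exact: pder_out.
have grad0 h : map_mx (ev z) (gradient dx h) = 0.
  by apply/matrixP => a b; rewrite !mxE d0.
have hess0 h : map_mx (ev z) (hess dx halfS metS cometS h) = 0.
  apply/matrixP => a b; rewrite !mxE rmorphB rmorph_sum big1 => [|c _].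
    by rewrite subr0; exact: d0.
  by rewrite rmorphM [X in _ * X]d0 mulr0.
have dot0 : ev z (dot dx cometS fpsi f) = 0.
  by rewrite /dot ev_entry !map_mxM grad0 mulmx0 mxE.
have lap0 : ev z (lap dx halfS metS cometS f) = 0.
  by rewrite /lap -trace_map_mx map_mxM hess0 mulmx0 mxtrace0.
by rewrite -[LHS]/(ev z _) /wlap rmorphB -[RHS](subr0 0); congr (_ - _).
Qed.

Section Solution.
Context (psi : M -> R) (psi_smooth : smooth_fun A psi) (m : R) (m_gt1 : 1 < m).
Context (u : R -> M -> R) (u_sol : positive_pme_solution G psi m T u).

Definition psiS : S := static 0 (psi_smooth i).

Lemma psiS_at t : 0 < t < T -> at_time t psiS (in_chart i psi).
Proof. by move=> tT x Ux; rewrite /= glue_in. Qed.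

Lemma u_smooth : smooth_spacetime `]0, T] (im i) (fun t => in_chart i (u t)).
Proof. by case: u_sol => _ _ us _; exact: us. Qed.

(** The solution, continued by 1 so that it is positive everywhere and its
    real powers are smooth. *)
Definition uS : S :=
  mk_smooth oD 1 (fun k => Ck_spacetime_Cdir oU (u_smooth k)).

Lemma uS_at t : 0 < t < T -> at_time t uS (in_chart i (u t)).
Proof. by move=> tT x Ux; rewrite /= glue_in. Qed.

Lemma uS_gt0 z : 0 < uS z.
Proof.
have [Dz|nDz] := pselect (cylinder T (im i) z); last by rewrite /= glue_out.
rewrite /= glue_in//; case: Dz => /andP[z0 zT] _.
by case: u_sol => up _ _ _; apply: up; rewrite !ltW.
Qed.

Definition kS : S := const spacetime_axis oD (m - 1).
(** The pressure. *)
Definition vS : S := const spacetime_axis oD (m / (m - 1)) * pow uS_gt0 (m - 1).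
(** The power of the solution to which the Laplacian is applied in the equation. *)
Definition fS : S := pow uS_gt0 m.
(** The weighted Laplacian of the pressure, p in the overview. *)
Definition PS : S := wlap dx halfS metS cometS psiS vS.

Lemma m1_neq0 : m - 1 != 0. Proof. by rewrite subr_eq0 gt_eqF. Qed.

Lemma uS_powS a z : uS z * pow uS_gt0 (a - 1) z = pow uS_gt0 a z.
Proof.
rewrite -[uS z in LHS]powRr1 ?ltW ?uS_gt0// -powRD; last first.
  by apply/implyP => _; rewrite gt_eqF ?uS_gt0.
by rewrite addrC subrK.
Qed.

(** Both sides are [m] times the derivative of [u] times its power [m - 1]. *)
Lemma der_fS j : pder (oD := oD) j fS = uS * pder j vS.
Proof.
rewrite (derivationM (der _)) pder_const mul0r add0r !pder_pow.
apply: smooth_fct_eq => z; rewrite !evM -(uS_powS (m - 1)) /=.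
by have := m1_neq0 => m1; field.
Qed.

Lemma der_vS j : uS * pder (oD := oD) j vS = kS * vS * pder j uS.
Proof.
rewrite (derivationM (der _)) pder_const mul0r add0r !pder_pow.
apply: smooth_fct_eq => z; rewrite !evM -(uS_powS (m - 1)) /=.
by have := m1_neq0 => m1; field.
Qed.

Lemma uS_inv : pow uS_gt0 (-1) * uS = 1.
Proof.
apply: smooth_fct_eq => z; rewrite evM.
have uz := uS_gt0 z; change (uS z `^ (-1) * uS z = 1).
by rewrite (powR_inv1 (ltW uz)) mulVf// gt_eqF.
Qed.

Lemma v_at t : 0 < t < T ->
  at_time t vS (in_chart i (fun p => m / (m - 1) * u t p `^ (m - 1))).
Proof.
move=> tT x Ux; rewrite evM; change (m / (m - 1) * uS (t, x) `^ (m - 1)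
  = in_chart i (fun p => m / (m - 1) * u t p `^ (m - 1)) x).
by rewrite (uS_at tT Ux).
Qed.

Lemma f_at t : 0 < t < T -> at_time t fS (in_chart i (fun p => u t p `^ m)).
Proof.
move=> tT x Ux; change (uS (t, x) `^ m = in_chart i (fun p => u t p `^ m) x).
by rewrite (uS_at tT Ux).
Qed.

Lemma dt_at t h (w : R -> M -> R) p : 0 < t < T -> dom A i p ->
  (forall s, 0 < s < T -> at_time s h (in_chart i (w s))) ->
  dt h (t, coord A i p) = dtime `]0, T] (w^~ p) t.
Proof.
move=> tT ip hw; have Dz : cylinder T (im i) (t, coord A i p).
  by split=> //; exact: im_coord.
have tI : nbhs t [set` `]0, T[].
  by apply: open_nbhs_nbhs; split; [exact: interval_open|rewrite /= in_itv].
rewrite (pderE _ _ Dz) dtime_interior; last first.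
  by apply: filterS tI => s /=; rewrite !in_itv /= => /andP[-> /ltW ->].
have := derivableP (@derivable_smooth _ _ _ _ _ oD None h _ Dz).
move/is_derive_time => /= -[_ <-].
apply: near_eq_derive; apply: filterS tI => s /=; rewrite in_itv /= => sT.
by rewrite (hw s sT _ (im_coord ip)) /in_chart coordK.
Qed.

(** Only values on the cylinder matter, since both sides vanish outside; there
    the equation is the hypothesis, in the chart [i]. *)
Lemma pme_S : dt uS = wlap dx halfS metS cometS psiS fS.
Proof.
apply: smooth_fct_eq => z.
have [[tT Ux]|nz] := pselect (cylinder T (im i) z); last first.
  by rewrite wlap_out// pder_out.
have [ip xE] := im_param Ux; set p := param A i z.2 in ip xE.
(* the equation is a hypothesis at points of the manifold *)
have -> : z = (z.1, coord A i p) by rewrite xE; case: (z).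
rewrite (dt_at tT ip uS_at).
rewrite (at_time_wlap (F := fun q => u z.1 q `^ m) tT ip (psiS_at tT) (f_at tT)).
have tT' : 0 < z.1 <= T by case/andP: tT => -> /ltW ->.
by have [_ _ _ /(_ z.1 i p tT' ip)] := u_sol.
Qed.

Let derx a : derivation (dx a) := der (Some a).
Let dxC a b f : dx a (dx b f) = dx b (dx a f) :=
  @pderC _ _ _ spacetime_axis _ oD (Some a) (Some b) f.
Let dtC a f : dt (dx a f) = dx a (dt f) :=
  @pderC _ _ _ spacetime_axis _ oD None (Some a) f.

Lemma pressure_S : dt vS = kS * vS * PS + dot dx cometS vS vS.
Proof.
apply: (pressure_equation derx dxC halfSP metST cometST metS_cometS uS_inv
  (fun a => der_fS (Some a)) (fun a => der_vS (Some a)) (der_vS None) pme_S).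
Qed.

Lemma evolution_S : dt PS = kS * vS * wlap dx halfS metS cometS psiS PS
  + (kS + 1) * dot dx cometS vS PS *+ 2 + kS * PS ^+ 2
  + (\tr (cometS *m hess dx halfS metS cometS vS *m (cometS *m hess dx halfS metS cometS vS))
     + ((gradvec dx cometS vS)^T *m (ric dx halfS metS cometS + hess dx halfS metS cometS psiS)
        *m gradvec dx cometS vS) 0 0) *+ 2.
Proof.
have H := (pressure_laplacian_evolution derx dxC halfSP metST cometST metS_cometS
  (der None) dtC dt_metS dt_cometS (dt_static 0 (psi_smooth i)) uS_inv
  (fun a => pder_const spacetime_axis oD (Some a) (m - 1))
  (fun a => der_fS (Some a)) (fun a => der_vS (Some a)) (der_vS None) pme_S).
exact: H.
Qed.

End Solution.
End ChartRing.

(** * The Bochner term under a lower bound on the weighted Ricci curvature *)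

Section Admissible.
Context {R : realType} {n : nat} {m : R} (m_gt1 : 1 < m).

Let k_gt0 : 0 < m - 1. Proof. by rewrite subr_gt0. Qed.

Lemma admissible_cases (N : \bar R) : admissible_dimension n m N ->
  N = +oo%E \/ exists2 r, N = r%:E & r < - 2 / (m - 1) \/ n%:R <= r.
Proof.
case: N => [r| |]; [right; exists r => //|by left|].
  by case: H; [case/andP => _; rewrite lte_fin; left|rewrite lee_fin; right].
by case; [case/andP|].
Qed.

Lemma ab_constant_ge0 (N : \bar R) : admissible_dimension n m N -> 0 <= ab_constant m N.
Proof.
case/admissible_cases => [->//|[r -> /= [rk|rn]]]; last first.
  have r0 : 0 <= r by apply: le_trans rn.
  by rewrite divr_ge0 ?addr_ge0 ?mulr_ge0// ltW.
have rk2 : r * (m - 1) < - 2 by rewrite -ltr_pdivlMr.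
by rewrite -mulrNN -invrN mulr_ge0 ?invr_ge0; lra.
Qed.

End Admissible.

Section BochnerBound.
Context {R : realType} {n : nat} {M : topologicalType}.
Context {A : smooth_manifold R n M} (G : riemannian_metric A).
Context (psi : M -> R) (m : R) (m_gt1 : 1 < m) (N : \bar R)
  (N_adm : admissible_dimension n m N)
  (psi_cst : N = (n%:R)%:E -> exists c, forall p, psi p = c)
  (Ric_ge0 : weighted_ricci_ge0 G psi N).
Context (i : chart A) (F : M -> R) (p : M) (ip : dom A i p).
Let x := coord A i p.
Context (HT : (hessian G i F x)^T = hessian G i F x).

Let C := cometric G i x.
Let H := hessian G i F x.
Let xi : 'rV[R]_n := differential i F x *m C.

(** The bracket of the evolution equation: the squared norm of the Hessian of
    [F] plus the curvature term in the direction of the gradient [xi] of [F]. *)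
Definition bochner_term : R :=
  \tr (C *m H *m (C *m H)) + (xi *m (ricci G i x + hessian G i psi x) *m xi^T) 0 0.

Lemma cometric_factor : exists Q : 'M[R]_n, C = Q *m Q^T.
Proof.
by apply: posdef_invmx_factor; [exact/met_sym/im_coord|exact/met_pos/im_coord].
Qed.

Lemma cometric_sym : C^T = C.
Proof. by have [Q ->] := cometric_factor; rewrite trmx_mul trmxK. Qed.

Lemma trace_square_ge0 : 0 <= \tr (C *m H *m (C *m H)).
Proof.
have [Q EQ] := cometric_factor; have := trace_hessian_sqr_le EQ HT.
have [n0 _|n0] := posnP n; last first.
  by move/(le_trans (sqr_ge0 _)); rewrite pmulr_rge0// ltr0n.
rewrite /mxtrace big1// => -[k kn] _; exfalso; by rewrite n0 in kn.
Qed.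

Lemma dim0_trace k (X : 'M[R]_k) : k = 0%N -> \tr X = 0.
Proof. by move=> k0; move: X; rewrite k0 => X; rewrite /mxtrace big_ord0. Qed.

Lemma dim0_mul k (X : 'rV[R]_k) (Y : 'cV[R]_k) : k = 0%N -> (X *m Y) 0 0 = 0.
Proof. by move=> k0; move: X Y; rewrite k0 => X Y; rewrite mxE big_ord0. Qed.

Lemma grad_dot_xi : grad_dot G i psi F p = (xi *m (differential i psi x)^T) 0 0.
Proof.
have tr00 (X : 'M[R]_1) : X 0 0 = X^T 0 0 by rewrite mxE.
by rewrite /grad_dot tr00 !trmx_mul trmxK -/x -/C cometric_sym mulmxA.
Qed.

Lemma partial_cst (f : 'rV[R]_n -> R) c a : f = cst c -> partial a f = cst 0.
Proof. by move=> ->; apply/funext => y; rewrite /partial derive_cst. Qed.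

Lemma differential_cst c : (forall q, psi q = c) -> differential i psi x = 0.
Proof.
move=> pc; apply/rowP => a; rewrite !mxE (@partial_cst _ c)//.
by apply/funext => y; rewrite /in_chart pc.
Qed.

Lemma hessian_cst c : (forall q, psi q = c) -> hessian G i psi x = 0.
Proof.
move=> pc; have E : in_chart i psi = cst c by apply/funext => y; rewrite /in_chart pc.
apply/matrixP => a b; rewrite !mxE (partial_cst b E) (partial_cst (c := 0) a)//.
by rewrite sub0r big1 ?oppr0// => d _; rewrite (partial_cst d E) mulr0.
Qed.

Lemma bochner_term_ge0 : N = +oo%E -> 0 <= bochner_term.
Proof.
move=> NE; rewrite addr_ge0 ?trace_square_ge0//.
by have := Ric_ge0 (im_coord ip) xi; rewrite NE.
Qed.

(** For [r] different from [n] the term in the differential of [psi], which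
    [weighted_ricci] subtracts, is added to the square of the trace of the Hessian
    by [weighted_trace_inequality]. For [r] equal to [n] the function [psi] is
    constant, and the inequality is that of Cauchy-Schwarz. *)
Lemma bochner_term_ge r : N = r%:E -> r != 0 ->
  weighted_laplacian G psi i F p ^+ 2 / r <= bochner_term.
Proof.
move=> NE r0; have [Q EQ] := cometric_factor.
have hB := trace_hessian_sqr_le EQ HT.
have := Ric_ge0 (im_coord ip) xi; rewrite NE /weighted_ricci -/x.
rewrite /weighted_laplacian /laplacian -/x -/C -/H /bochner_term.
case: eqP => [rn|/eqP rn].
  have [c pc] : exists c, forall q, psi q = c by apply: psi_cst; rewrite NE rn.
  rewrite (hessian_cst pc) grad_dot_xi (differential_cst pc) trmx0 mulmx0 [X in _ - X]mxE.
  rewrite addr0 subr0 => ric0.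
  have n0 : 0 < n%:R :> R by rewrite lt_neqAle eq_sym -rn r0 rn ler0n.
  apply: (@le_trans _ _ (\tr (C *m H *m (C *m H)))); last by rewrite lerDl.
  by rewrite rn ler_pdivrMr// mulrC.
set s := grad_dot G i psi F p => wric.
have Es : (xi *m ((differential i psi x)^T *m differential i psi x) *m xi^T) 0 0 = s ^+ 2.
  have tr00 (X : 'M[R]_1) : X 0 0 = X^T 0 0 by rewrite mxE.
  rewrite mulmxA -mulmxA mxE big_ord1 -grad_dot_xi -/s expr2; congr (_ * _).
  by rewrite tr00 trmx_mul trmxK -grad_dot_xi.
have rN : r < 0 \/ n%:R <= r.
  have := admissible_cases N_adm; rewrite NE => -[//|[q [<-] [rk|nr]]]; last by right.
  by left; apply: (lt_trans rk); rewrite mulNr oppr_lt0 divr_gt0// subr_gt0.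
have dim0 : n = 0%N -> \tr (C *m H) = 0 /\ s = 0.
  by move=> n0; rewrite dim0_trace// /s grad_dot_xi dim0_mul.
have := weighted_trace_inequality rn rN dim0 hB (fun _ => trace_square_ge0).
move=> main; apply: (le_trans main); rewrite lerD2l.
move: wric; rewrite mulmxBr mulmxBl -scalemxAr -scalemxAl.
rewrite ![(_ + _ : matrix _ _ _) 0 0]mxE ![(- _ : matrix _ _ _) 0 0]mxE ![(_ *: _ : matrix _ _ _) 0 0]mxE Es.
by rewrite subr_ge0.
Qed.

(** The admissible dimension 0 only occurs when the manifold has dimension 0. *)
Lemma wlap_dim0 : N = 0%:E -> weighted_laplacian G psi i F p = 0.
Proof.
move=> NE; have n0 : n = 0%N.
  have := admissible_cases N_adm; rewrite NE => -[//|[q [<-] [|]]]; last first.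
    by rewrite lern0 => /eqP.
  by rewrite mulNr oppr_gt0 ltNge ltW// divr_gt0// subr_gt0.
by rewrite /weighted_laplacian /laplacian dim0_trace// grad_dot_xi dim0_mul// subr0.
Qed.

(** [pt] and [vw] stand for the time derivative of p and for the term of the
    evolution equation with second derivatives of p, at a minimum. *)
Lemma pressure_minimum_bound (tau pt vw : R) : 0 < tau -> 0 <= vw ->
  pt = vw + (m - 1) * weighted_laplacian G psi i F p ^+ 2 + bochner_term *+ 2 ->
  weighted_laplacian G psi i F p + tau * pt <= 0 ->
  - ab_constant m N <= tau * ((m - 1) * weighted_laplacian G psi i F p).
Proof.
set P := weighted_laplacian _ _ _ _ _ => tau0 vw0 ptE Hpt.
have k0 : 0 < m - 1 by rewrite subr_gt0.
have {}Hpt : P + tau * ((m - 1) * P ^+ 2 + bochner_term *+ 2) <= 0.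
  by apply: le_trans Hpt; rewrite lerD2l ler_pM2l// ptE -addrA lerDr.
case: (admissible_cases N_adm) => [NE|[r NE rk]].
  rewrite {1}NE /=; apply: minimum_bound_oo Hpt => //; exact: bochner_term_ge0.
rewrite {1}NE /=; have [r0|r0] := eqVneq r 0.
  by rewrite /P wlap_dim0 ?NE ?r0// !mul0r mulr0 mulr0 oppr0.
apply: (minimum_bound k0 tau0 r0 _ (bochner_term_ge NE r0) Hpt).
by case: rk => [|nr]; [left|right; rewrite lt_neqAle eq_sym r0 (le_trans _ nr)].
Qed.

End BochnerBound.

(** * The minimum principle *)

Lemma slice_Cdir (R : realType) n (T : R) (U : set 'rV[R]_n) k
    (F : R * 'rV[R]_n -> R) t : open U -> 0 < t < T ->
  Cdir spacetime_axis k (cylinder T U) F -> Cdir axis k U (fun x => F (t, x)).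
Proof.
move=> oU tT; have inD x : U x -> cylinder T U (t, x) by [].
have cont (H : R * 'rV[R]_n -> R) :
    (forall z, cylinder T U z -> {for z, continuous H}) ->
    forall x, U x -> {for x, continuous (fun x => H (t, x))}.
  move=> cH x /inD /cH cx.
  change {for x, continuous (H \o (fun y => (t, y)))}.
  apply: continuous_comp; last exact: cx.
  exact: (@cvg_pair _ _ _ (nbhs x) (nbhs t) (nbhs x) _ _ _ (fun=> t) id
    (cvg_cst t) (fun S xS => xS)).
elim: k F => [|k IHk] F [cF dF]; first by split => //; exact: cont.
split; first exact: cont.
move=> l; have [dl Cl] := dF (Some l).
have dw x : U x -> is_derive x (axis l) (fun x => F (t, x))
    ('D_(spacetime_axis (Some l)) F (t, x)).
  by move=> Ux; apply: (is_derive_space F (t, x) l _).2; exact/derivableP/dl.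
split; first by move=> x /dw[].
by apply: (Cdir_ext oU _ (IHk _ Cl)) => x /dw[_ ->].
Qed.

Lemma left_derivative_le0 (R : realType) (g : R -> R) (a t d : R) : a < t ->
  is_derive t 1 g d -> (forall s, a <= s <= t -> g t <= g s) -> d <= 0.
Proof.
move=> at_ [gd gE] gmin; rewrite leNgt; apply/negP => d0.
have Q : h^-1 *: ((g \o shift t) (h *: (1 : R)) - g t) @[h --> (0 : R)^'] --> d.
  by rewrite -gE; exact: gd.
have Q' : \forall r \near (0 : R)^', 0 < r^-1 *: ((g \o shift t) (r *: (1 : R)) - g t).
  exact: (cvgr_gt _ Q).
move: Q'; rewrite near_withinE => -[e /= e0 eP].
pose r := Num.min (t - a) (e / 2).
have r0 : 0 < r by rewrite lt_min subr_gt0 at_ divr_gt0.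
have ra : r <= t - a by rewrite ge_min lexx.
have re : r < e by rewrite gt_min ltr_pdivrMr// ltr_pMr// ltr1n orbT.
have /eP : ball (0 : R) e (- r) by rewrite /ball /= sub0r opprK gtr0_norm.
have rN0 : - r != 0 by rewrite oppr_eq0 gt_eqF.
move=> /(_ rN0) /=; rewrite [- r *: 1]mulr1 /GRing.scale /= invrN mulNr oppr_gt0.
rewrite pmulr_rlt0 ?invr_gt0// subr_lt0 ltNge gmin//.
by apply/andP; split; lra.
Qed.

Section Main.
Context {R : realType} {n : nat} {M : topologicalType}.
Context {A : smooth_manifold R n M} (G : riemannian_metric A).
Context (M_compact : compact [set: M]).
Context (psi : M -> R) (psi_smooth : smooth_fun A psi).
Context (m T : R) (m_gt1 : 1 < m) (T_gt0 : 0 < T).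
Context (u : R -> M -> R) (u_sol : positive_pme_solution G psi m T u).
Context (N : \bar R) (N_adm : admissible_dimension n m N).
Context (psi_cst : N = (n%:R)%:E -> exists c, forall p, psi p = c).
Context (Ric_ge0 : weighted_ricci_ge0 G psi N).

Definition pressure (t : R) (p : M) : R := m / (m - 1) * u t p `^ (m - 1).
Local Notation v := pressure.

(** The left-hand side of the Aronson-Benilan estimate, with [v] expressed
    through [u]. *)
Definition ab_quantity (i : chart A) (t : R) (p : M) : R :=
  grad_dot G i (v t) (v t) p / v t p - dtime `]0, T] (v^~ p) t / v t p.

Let k_gt0 : 0 < m - 1. Proof. by rewrite subr_gt0. Qed.

Lemma pressure_gt0 t p : 0 <= t <= T -> 0 < v t p.
Proof.
move=> tT; rewrite mulr_gt0 ?divr_gt0 ?powR_gt0//; first by rewrite (lt_trans ltr01).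
by case: u_sol => up _ _ _; exact: up.
Qed.

Section InChart.
Variable i : chart A.
Let oU : open (im i) := open_im (i := i).
Let oD := open_cylinder (T := T) oU.
Local Notation dx := (fun a : 'I_n => pder (oD := oD) (Some a)).
Local Notation dt := (pder (oD := oD) None).
Local Notation g := (metS G i T).
Local Notation C := (cometS G i T).
Local Notation hf := (halfS i T).
Local Notation P := (PS i psi_smooth u_sol).
Local Notation V := (vS i u_sol).

Lemma V_at t : 0 < t < T -> at_time t V (in_chart i (v t)).
Proof. exact: v_at. Qed.

Lemma smooth_pressure t k : 0 < t < T -> Cdir axis k (im i) (in_chart i (v t)).
Proof.
move=> tT; apply: Cdir_ext (slice_Cdir oU tT (smooth_fctP V k)) => //.
exact: V_at.
Qed.

(** Divide [pressure_S] by the pressure. *)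
Lemma ab_quantityE t p : 0 < t < T -> dom A i p ->
  ab_quantity i t p = - ((m - 1) * P (t, coord A i p)).
Proof.
move=> tT ip; have Ux := im_coord ip.
have tT' : 0 <= t <= T by case/andP: tT => /ltW -> /ltW ->.
have vp := pressure_gt0 p tT'.
have E1 := dt_at tT ip (w := v) V_at.
have E2 := at_time_dot G tT ip (V_at tT) (V_at tT).
have E3 : V (t, coord A i p) = v t p by rewrite (V_at tT Ux) /in_chart coordK.
have := congr1 (fun f => smooth_val f (t, coord A i p)) (pressure_S i psi_smooth m_gt1 u_sol).
rewrite evD 2!evM E1 E2 E3 /ab_quantity => ->.
set X := grad_dot _ _ _ _ _; set Y := P _; set w := v t p.
change (X / w - ((m - 1) * w * Y + X) / w = - ((m - 1) * Y)).
by field; rewrite gt_eqF.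
Qed.

(** At a critical point of p the Hessian is the matrix of second derivatives,
    which is nonnegative at a minimum, and so is its trace against the positive
    definite cometric. *)
Lemma spatial_minimum t p : 0 < t < T -> dom A i p ->
  (forall y, im i y -> P (t, coord A i p) <= P (t, y)) ->
  dot dx C V P (t, coord A i p) = 0 /\
  0 <= wlap dx hf g C (psiS i T psi_smooth) P (t, coord A i p).
Proof.
move=> tT ip Pmin; set x := coord A i p; have Ux := im_coord ip.
have CP := slice_Cdir oU tT (smooth_fctP P 2).
have [grad0 hess0] := second_order_minimum oU Ux CP Pmin.
have dP a : ev (t, x) (dx a P) = 0.
  by rewrite -(grad0 a); exact: (at_time_dx tT (h := fun y => P (t, y)) a _ Ux).
have gradP : map_mx (ev (t, x)) (gradient dx P) = 0.
  by apply/matrixP => a b; rewrite !mxE; exact: dP.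
have dot0 f : ev (t, x) (dot dx C f P) = 0.
  by rewrite /dot ev_entry !map_mxM gradP mulmx0 mxE.
split; first exact: dot0.
have Eh : map_mx (ev (t, x)) (hess dx hf g C P) =
    \matrix_(a, b) partial a (partial b (fun y => P (t, y))) x.
  apply/matrixP => a b; rewrite !mxE rmorphB rmorph_sum.
  rewrite [X in _ - X]big1 => [|c _]; last by rewrite rmorphM [X in _ * X]dP mulr0.
  rewrite subr0; exact: (at_time_dx tT a (at_time_dx tT (h := fun y => P (t, y)) b _) Ux).
have [Q EQ] := cometric_factor G ip.
suff : 0 <= ev (t, x) (lap dx hf g C P).
  move=> lap0; apply: (le_trans lap0); rewrite -[leRHS]/(ev (t, x) _) /wlap rmorphB.
  by rewrite [X in _ - X]dot0 subr0.
rewrite /lap -trace_map_mx map_mxM Eh cometS_in//.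
apply: (mxtrace_posdef_ge0 EQ) => xi; have := hess0 xi.
suff -> : \sum_k \sum_l xi 0 k * xi 0 l * partial l (partial k (fun y => P (t, y))) x =
  (xi *m \matrix_(a, b) partial a (partial b (fun y => P (t, y))) x *m xi^T) 0 0 by [].
rewrite mxE; apply: eq_bigr => k _; rewrite !mxE big_distrl /=.
by apply: eq_bigr => l _; rewrite !mxE; ring.
Qed.

Lemma hessian_pressure_sym t p : 0 < t < T -> dom A i p ->
  (hessian G i (v t) (coord A i p))^T = hessian G i (v t) (coord A i p).
Proof.
move=> tT ip; rewrite -(at_time_hess G tT (im_coord ip) (V_at tT)) map_trmx hessT//.
  by move=> a b f; exact: pderC.
exact: metST.
Qed.

Lemma evolution_at t p : 0 < t < T -> dom A i p ->
  dt P (t, coord A i p) =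
    ((m - 1) * v t p * wlap dx hf g C (psiS i T psi_smooth) P (t, coord A i p)
     + m * dot dx C V P (t, coord A i p) *+ 2)
    + (m - 1) * P (t, coord A i p) ^+ 2
    + bochner_term G psi i (v t) p *+ 2.
Proof.
move=> tT ip; set x := coord A i p; have Ux : im i x := im_coord ip.
set z := (t, x).
have Hv := at_time_hess G tT Ux (V_at tT).
have E1 : ev z (\tr (C *m hess dx hf g C V *m (C *m hess dx hf g C V))) =
    \tr (cometric G i x *m hessian G i (v t) x *m (cometric G i x *m hessian G i (v t) x)).
  by rewrite -trace_map_mx !map_mxM Hv cometS_in.
have Eg : map_mx (ev z) (gradvec dx C V) =
    (differential i (v t) x *m cometric G i x)^T.
  rewrite /gradvec map_mxM (at_time_gradient tT Ux (V_at tT)) cometS_in//.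
  by rewrite trmx_mul cometric_sym.
have E2 : ev z (((gradvec dx C V)^T *m (ric dx hf g C
      + hess dx hf g C (psiS i T psi_smooth)) *m gradvec dx C V) 0 0) =
    ((differential i (v t) x *m cometric G i x) *m (ricci G i x + hessian G i psi x)
      *m (differential i (v t) x *m cometric G i x)^T) 0 0.
  rewrite ev_entry 2!map_mxM -map_trmx map_mxD Eg trmxK (at_time_ric G tT Ux).
  by rewrite (at_time_hess G tT Ux (psiS_at psi_smooth tT)).
have E3 : ev z V = v t p by rewrite /ev (V_at tT Ux) /in_chart coordK.
have morph (k w W D Q X Y : smooth_fct spacetime_axis oD) :
    ev z (k * w * W + (k + 1) * D *+ 2 + k * Q ^+ 2 + (X + Y) *+ 2) =
    ev z k * ev z w * ev z W + (ev z k + 1) * ev z D *+ 2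
    + ev z k * ev z Q ^+ 2 + (ev z X + ev z Y) *+ 2.
  by rewrite !(rmorphD, rmorphMn, rmorphM, rmorphXn, rmorph1).
rewrite -[LHS]/(ev z _) (evolution_S i psi_smooth m_gt1 u_sol) morph E1 E2 E3.
have -> : ev z (kS i T m) = m - 1 by [].
by rewrite subrK.
Qed.

End InChart.
Lemma ab_quantity_change_chart (i j : chart A) t p : 0 < t < T ->
  dom A i p -> dom A j p -> ab_quantity i t p = ab_quantity j t p.
Proof.
move=> tT ip jp.
by rewrite /ab_quantity (grad_dot_change_chart G ip jp (smooth_pressure j 1 tT)).
Qed.

Lemma near_time t (p : M) (i : chart A) : 0 < t < T -> dom A i p ->
  \forall z \near (t, p), 0 < z.1 < T /\ dom A i z.2.
Proof.
move=> tT ip; have oI : open [set` `]0, T[] by exact: interval_open.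
have N1 : nbhs t [set` `]0, T[].
  by apply: open_nbhs_nbhs; split => //; rewrite /= in_itv.
have N2 : nbhs p (dom A i) by apply: open_nbhs_nbhs; split => //; exact: dom_open.
have H1 : \forall z \near (t, p), [set` `]0, T[] z.1 by exact: (@cvg_fst _ _ (nbhs t) (nbhs p) _ _ N1).
have H2 : \forall z \near (t, p), dom A i z.2 by exact: (@cvg_snd _ _ (nbhs t) (nbhs p) _ _ N2).
by apply: filterS2 H1 H2 => z /=; rewrite in_itv.
Qed.

(** Near [p] the quantity is given by the single smooth function [PS] of the chart
    at [p], whatever the charts chosen at the other points. *)
Lemma weighted_quantity_continuous (ch : M -> chart A) eps t p :
  (forall q, dom A (ch q) q) -> 0 < t < T ->
  {for (t, p), continuous (fun z : R * M => (z.1 - eps) * - ab_quantity (ch z.2) z.1 z.2)}.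
Proof.
move=> chP tT; set i := ch p.
have ip : dom A i p := chP p.
have E : \forall z \near (t, p),
    (z.1 - eps) * ((m - 1) * PS i psi_smooth u_sol (z.1, coord A i z.2)) =
    (z.1 - eps) * - ab_quantity (ch z.2) z.1 z.2.
  apply: filterS (near_time tT ip) => z [zT iz].
  by rewrite (ab_quantity_change_chart zT (chP z.2) iz) (ab_quantityE zT iz) opprK.
have cP : {for (t, coord A i p), continuous (PS i psi_smooth u_sol)}.
  by apply: (Cdir_cont (smooth_fctP (PS i psi_smooth u_sol) 0)); split => //; exact: im_coord.
have cS : {for (t, p), continuous (fun z : R * M => PS i psi_smooth u_sol (z.1, coord A i z.2))}.
  change {for (t, p), continuous
    (PS i psi_smooth u_sol \o (fun z : R * M => (z.1, coord A i z.2)))}.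
  apply: continuous_comp; last exact: cP.
  apply: (@cvg_pair _ _ _ (nbhs (t, p)) (nbhs t) (nbhs (coord A i p)) _ _ _ fst
    (coord A i \o snd)); first exact: cvg_fst.
  by apply: (cvg_comp snd (coord A i)) ; [exact: cvg_snd|exact: Defs.coord_continuous].
have cL : {for (t, p), continuous (fun z : R * M =>
    (z.1 - eps) * ((m - 1) * PS i psi_smooth u_sol (z.1, coord A i z.2)))}.
  apply: continuousM.
    by apply: continuousB; [exact: cvg_fst|exact: cvg_cst].
  by apply: continuousM; [exact: cvg_cst|exact: cS].
rewrite /prop_for /continuous_at -(nbhs_singleton E).
by apply: cvg_trans cL; apply: near_eq_cvg; apply: filterS E => z ->.
Qed.

(** The minimum may be attained at the last time [tau], which is why the time
    derivative is only known to be nonpositive there; for the bound this is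
    enough. *)
Lemma minimum_point_bound eps tau t0 p0 (i : chart A) :
  0 < eps -> tau < T -> eps < t0 <= tau -> dom A i p0 ->
  (forall t q j, eps <= t <= tau -> dom A j q ->
    (t0 - eps) * - ab_quantity i t0 p0 <= (t - eps) * - ab_quantity j t q) ->
  - ab_constant m N <= (t0 - eps) * - ab_quantity i t0 p0.
Proof.
move=> eps0 tauT /andP[et0 t0tau] ip0 Wmin.
have t0T : 0 < t0 < T by apply/andP; split; [exact: lt_trans et0|exact: le_lt_trans tauT].
have t0T' : 0 <= t0 <= T by case/andP: t0T => /ltW -> /ltW ->.
have tau0 : 0 < t0 - eps by rewrite subr_gt0.
set P := PS i psi_smooth u_sol; pose x := coord A i p0.
have Ux : im i x := im_coord ip0.
have WP t y : eps <= t <= tau -> im i y ->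
    (t0 - eps) * ((m - 1) * P (t0, x)) <= (t - eps) * ((m - 1) * P (t, y)).
  move=> /andP[et ttau] /im_param[iy yE].
  have tT : 0 < t < T by apply/andP; split; [exact: lt_le_trans et|exact: le_lt_trans tauT].
  have := Wmin t _ i; rewrite et ttau => /(_ _ isT iy).
  by rewrite (ab_quantityE t0T ip0) (ab_quantityE tT iy) !opprK yE.
have t0I : eps <= t0 <= tau by rewrite (ltW et0) t0tau.
have Pmin y : im i y -> P (t0, x) <= P (t0, y).
  by move=> /(WP t0 _ t0I); rewrite ler_pM2l// ler_pM2l.
have [dot0 wlap0] := spatial_minimum t0T ip0 Pmin.
have Dt : is_derive t0 1 (fun s : R => (s - eps) * ((m - 1) * P (s, x)))
    ((m - 1) * (P (t0, x) + (t0 - eps) * pder None P (t0, x))).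
  have Dz : cylinder T (im i) (t0, x) by [].
  have dP : is_derive t0 1 (fun s : R => P (s, x)) (pder None P (t0, x)).
    rewrite (pderE _ _ Dz); apply: (is_derive_time P (t0, x) _).2.
    exact/derivableP/(@derivable_smooth _ _ _ _ _ _ None P _ Dz).
  have [H1 H2] := is_deriveM (is_deriveB (is_derive_id t0 (1 : R)) (is_derive_cst eps t0 (1 : R)))
    (is_deriveZ (m - 1) dP).
  split; first exact: H1.
  apply: etrans H2 _; move: (pder _ _ _) => q.
  change ((t0 - eps) * ((m - 1) * q) + (m - 1) * P (t0, x) * (1 - 0) =
    (m - 1) * (P (t0, x) + (t0 - eps) * q)).
  by move: (P _) => r; ring.
have := left_derivative_le0 et0 Dt.
have gmin s : eps <= s <= t0 -> (t0 - eps) * ((m - 1) * P (t0, x)) <=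
   (s - eps) * ((m - 1) * P (s, x)).
  by move=> /andP[es st]; apply: WP => //; rewrite es (le_trans st).
move=> /(_ gmin); rewrite pmulr_rle0// => Ht.
have Pw : weighted_laplacian G psi i (v t0) p0 = P (t0, x).
  by apply/esym; exact: (at_time_wlap G t0T ip0 (psiS_at psi_smooth t0T) (V_at t0T)).
rewrite (ab_quantityE t0T ip0) opprK -[coord A i p0]/x -/P -Pw.
apply: (pressure_minimum_bound m_gt1 N_adm psi_cst Ric_ge0 ip0
  (hessian_pressure_sym t0T ip0) tau0 (pt := pder None P (t0, x))).
- exact: mulr_ge0 (mulr_ge0 (ltW k_gt0) (ltW (pressure_gt0 p0 t0T'))) wlap0.
- by rewrite Pw (evolution_at t0T ip0) dot0 mulr0 mul0rn addr0.
- by rewrite Pw.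
Qed.

(** The factor [t - eps] makes the minimised function vanish at the initial time,
    where nothing is known about p; a minimum attained there is thus at least
    [- ab_constant m N], which is nonpositive. *)
Lemma ab_bound_from eps tau (i : chart A) p : 0 < eps -> eps < tau -> tau < T ->
  dom A i p -> - ab_constant m N <= (tau - eps) * - ab_quantity i tau p.
Proof.
move=> eps0 et tauT ip.
have [ch chP] := choice (dom_cover A).
(* a chart is chosen at every point to define one function on the manifold *)
pose W (z : R * M) := (z.1 - eps) * - ab_quantity (ch z.2) z.1 z.2.
pose K : set (R * M) := `[eps, tau] `*` [set: M].
have Kc : compact K by apply: compact_setX => //; exact: segment_compact.
have K0 : K !=set0 by exists (tau, p); split => //=; rewrite in_itv /= lexx ltW.
have inT t : eps <= t <= tau -> 0 < t < T.
  by move=> /andP[e1 e2]; apply/andP; split; [exact: lt_le_trans e1|exact: le_lt_trans tauT].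
have Wc : {within K, continuous W}.
  apply: continuous_in_subspaceT => -[t q] /set_mem[/=]; rewrite in_itv /= => tI _.
  exact: weighted_quantity_continuous chP (inT t tI).
have [[t0 p0] /set_mem[/= t0I _] Wmin] := compact_EVT_min K0 Kc Wc.
rewrite in_itv /= in t0I.
have WminE t q j : eps <= t <= tau -> dom A j q ->
    W (t0, p0) <= (t - eps) * - ab_quantity j t q.
  move=> tI jq; rewrite (ab_quantity_change_chart (inT t tI) jq (chP q)).
  by apply: (Wmin (t, q)); apply/mem_set; split => //=; rewrite in_itv.
apply: (le_trans _ (WminE tau p i _ ip)); last by rewrite lexx ltW.
case/andP: (t0I); rewrite le_eqVlt => /orP[/eqP <- _|et0 t0tau].
  by rewrite /W /= subrr mul0r oppr_le0 (ab_constant_ge0 m_gt1 N_adm).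
by apply: (minimum_point_bound eps0 tauT) WminE; rewrite ?et0.
Qed.

(** Let [eps] tend to 0 in [ab_bound_from]. *)
Lemma interior_bound t (i : chart A) p : 0 < t < T -> dom A i p ->
  ab_quantity i t p <= ab_constant m N / t.
Proof.
move=> /andP[t0 tT] ip; rewrite ler_pdivlMr// mulrC.
apply/ler_addgt0Pr => d d0; set a := ab_constant m N; set q := ab_quantity i t p.
(* replacing [t] by [t - e] changes the product with [q] by at most [d] *)
pose e := Num.min (t / 2) (d / (`|q| + 1)).
have q1 : 0 < `|q| + 1 by rewrite ltr_wpDl.
have e0 : 0 < e by rewrite lt_min !divr_gt0.
have et : e < t by rewrite gt_min ltr_pdivrMr// ltr_pMr// ltr1n.
have ed : e * (`|q| + 1) <= d by rewrite -ler_pdivlMr// ge_min lexx orbT.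
have := ab_bound_from e0 et tT ip; rewrite -/a -/q => H.
have : e * q <= d.
  apply: le_trans ed; rewrite ler_pM2l//; have := ler_norm q; lra.
have -> : t * q = (t - e) * q + e * q by ring.
lra.
Qed.

End Main.

(** * The final time *)

Section FinalTime.
Context {R : realType} (T : R) (T_gt0 : 0 < T).

Lemma left_halfopen t : 0 < t <= T ->
  \forall s \near t^'-, s < t /\ [set` `]0, T]] s.
Proof.
move=> /andP[t0 tT]; apply: filterS2 (nbhs_left_gt t0) (nbhs_left_lt t) => s s0 st.
by rewrite /= in_itv /= s0 (le_trans (ltW st)).
Qed.

(** Makes limits along the half-open time interval unique, up to its end point. *)
Lemma halfopen_proper t : 0 < t <= T -> ProperFilter (within [set` `]0, T]] (dnbhs t)).
Proof.
move=> tT; apply: Build_ProperFilter => HB.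
have H0 : \forall s \near t, s != t -> [set` `]0, T]] s -> False := HB.
have HN : \forall s \near t^'-, s != t -> [set` `]0, T]] s -> False.
  by move: H0; exact: cvg_within.
have HL : \forall s \near t^'-, False.
  by apply: filterS2 (left_halfopen tT) HN => s [st sJ] H; apply: H => //; rewrite lt_eqF.
by have [] := filter_ex HL.
Qed.

Lemma cvg_to_final_time n (U : set 'rV[R]_n) (w : R -> 'rV[R]_n -> R) x :
  {within `]0, T] `*` U, continuous (fun z : R * 'rV[R]_n => w z.1 z.2)} -> U x ->
  w t x @[t --> T^'-] --> w T x.
Proof.
move=> /subspace_continuousP cw Ux.
have JT : (`]0, T] `*` U) (T, x) by split => //=; rewrite in_itv /= T_gt0 lexx.
have TT : 0 < T <= T by rewrite T_gt0 lexx.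
move=> B /(cw _ JT) /= HB.
have pT : (t, x) @[t --> T^'-] --> (T, x).
  apply: (@cvg_pair _ _ _ T^'- (nbhs T) (nbhs x) _ _ _ id (fun=> x)); last exact: cvg_cst.
  exact: cvg_within.
have := pT _ HB.
by apply: filterS2 (left_halfopen TT) => t [_ tJ]; apply.
Qed.

End FinalTime.

Section Endpoint.
Context {R : realType} {n : nat} {M : topologicalType}.
Context {A : smooth_manifold R n M} (G : riemannian_metric A).
Context (psi : M -> R) (m T : R) (m_gt1 : 1 < m) (T_gt0 : 0 < T).
Context (u : R -> M -> R) (u_sol : positive_pme_solution G psi m T u).
Context (i : chart A) (p : M) (ip : dom A i p).
Let x := coord A i p.
Let Ux : im i x := im_coord ip.
Let w t := in_chart i (u t).

Let c t := m * u t p `^ (m - 1 - 1).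

Let u_gt0 t : 0 < t <= T -> 0 < u t p.
Proof. by case: u_sol => up _ _ _ /andP[t0 tT]; apply: up; rewrite ltW. Qed.

Let us : Ck_spacetime 1 `]0, T] (im i) w.
Proof. by case: u_sol => _ _ us _; exact: us. Qed.

Lemma is_derive_pressure_law (a : R) : 0 < a ->
  is_derive a 1 (fun y => m / (m - 1) * y `^ (m - 1)) (m * a `^ (m - 1 - 1)).
Proof.
move=> a0; have := is_deriveZ (m / (m - 1)) (is_derive1_powR (m - 1) a0).
suff -> : m / (m - 1) *: ((m - 1) * a `^ (m - 1 - 1)) = m * a `^ (m - 1 - 1) by [].
by rewrite /GRing.scale /= mulrA divfK// subr_eq0 gt_eqF.
Qed.

Lemma partial_pressure t k : 0 < t <= T ->
  partial k (in_chart i (pressure m u t)) x = c t * partial k (w t) x.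
Proof.
move=> tT; have [_ [_ /(_ k)[dk _]]] := us.
have tJ : [set` `]0, T]] t by rewrite /= in_itv.
have wx : w t x = u t p by rewrite /w /in_chart coordK.
have H : is_derive (w t x) 1 (fun y => m / (m - 1) * y `^ (m - 1)) (c t).
  by rewrite wx; apply: is_derive_pressure_law; exact: u_gt0.
by have [_ E] := is_derive_comp H (derivableP (dk t x tJ Ux)); exact: E.
Qed.

Lemma dtime_pressure t : 0 < t <= T ->
  dtime `]0, T] ((pressure m u)^~ p) t = c t * dtime `]0, T] (u^~ p) t.
Proof.
move=> tT; have [_ [[dt _] _]] := us.
have tJ : [set` `]0, T]] t by rewrite /= in_itv.
have wE : w^~ x = u^~ p by apply/funext => s; rewrite /w /in_chart coordK.
have := dt t x tJ Ux; rewrite wE => du.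
exact: (dtime_comp (halfopen_proper tT) (is_derive_pressure_law (u_gt0 tT)) du).
Qed.

(** In terms of [u] the quantity only involves first derivatives that are
    continuous up to the time [T]. *)
Lemma ab_quantity_formula t : 0 < t <= T -> ab_quantity G m T u i t p =
  (c t ^+ 2 * grad_dot G i (u t) (u t) p - c t * dtime `]0, T] (u^~ p) t)
  / pressure m u t p.
Proof.
move=> tT; rewrite /ab_quantity (dtime_pressure tT) mulrBl; congr (_ / _ - _).
rewrite /grad_dot -/x.
have -> : differential i (pressure m u t) x = c t *: differential i (u t) x.
  by apply/rowP => k; rewrite !mxE (partial_pressure k tT).
by rewrite linearZ /= -!scalemxAl -scalemxAr scalerA mxE expr2.
Qed.

Lemma ab_quantity_cvg :
  ab_quantity G m T u i t p @[t --> T^'-] --> ab_quantity G m T u i T p.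
Proof.
have TT : 0 < T <= T by rewrite T_gt0 lexx.
rewrite (ab_quantity_formula TT).
have near_formula : \forall t \near T^'-, 
    (c t ^+ 2 * grad_dot G i (u t) (u t) p - c t * dtime `]0, T] (u^~ p) t)
    / pressure m u t p = ab_quantity G m T u i t p.
  apply: filterS (left_halfopen TT) => t [_]; rewrite /= in_itv /= => tT.
  by rewrite (ab_quantity_formula tT).
have [cw [[_ [cdt _]] dx]] := us.
have wE : w^~ x = u^~ p by apply/funext => s; rewrite /w /in_chart coordK.
have cu : u t p @[t --> T^'-] --> u T p.
  have := cvg_to_final_time T_gt0 cw Ux.
  by rewrite -[(fun t => w t x)]/(w^~ x) wE /w /in_chart coordK.
have cdu : dtime `]0, T] (u^~ p) t @[t --> T^'-] --> dtime `]0, T] (u^~ p) T.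
  by have := cvg_to_final_time (w := fun t x => dtime `]0, T] (w^~ x) t) T_gt0 cdt Ux; rewrite wE.
have cpow a : u t p `^ a @[t --> T^'-] --> u T p `^ a.
  have D : {for u T p, continuous (fun y : R => y `^ a)}.
    apply/differentiable_continuous/derivable1_diffP.
    by have [] := is_derive1_powR a (u_gt0 TT).
  exact: (cvg_comp (u^~ p) (fun y => y `^ a) cu D).
have cc : c t @[t --> T^'-] --> c T by apply: cvgM; [exact: cvg_cst|exact: cpow].
have cdx k : partial k (w t) x @[t --> T^'-] --> partial k (w T) x.
  by have [_ [ck _]] := dx k; exact: (cvg_to_final_time (w := fun t => partial k (w t)) T_gt0 ck Ux).
have cgrad : grad_dot G i (u t) (u t) p @[t --> T^'-] --> grad_dot G i (u T) (u T) p.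
  have gE t : grad_dot G i (u t) (u t) p =
      \sum_b (\sum_a partial a (w t) x * cometric G i x a b) * partial b (w t) x.
    rewrite /grad_dot mxE; apply: eq_bigr => b _; rewrite !mxE; congr (_ * _).
    by apply: eq_bigr => a _; rewrite mxE.
  rewrite gE (_ : (fun t => _) = (fun t => \sum_b (\sum_a partial a (w t) x
    * cometric G i x a b) * partial b (w t) x)); last by apply/funext => t; rewrite gE.
  apply: cvg_big => [|b _]; first exact: add_continuous.
  apply: cvgM; last exact: cdx.
  apply: cvg_big => [|a _]; first exact: add_continuous.
  by apply: cvgM; [exact: cdx|exact: cvg_cst].
have L : (c t ^+ 2 * grad_dot G i (u t) (u t) p - c t * dtime `]0, T] (u^~ p) t)
    / pressure m u t p @[t --> T^'-] -->
    (c T ^+ 2 * grad_dot G i (u T) (u T) p - c T * dtime `]0, T] (u^~ p) T)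
    / pressure m u T p.
  apply: cvgM.
    apply: cvgB; last exact: (cvgM cc cdu).
    by apply: (cvgM _ cgrad); exact: (cvgM cc cc).
  apply: cvgV; last by apply: cvgM; [exact: cvg_cst|exact: cpow].
  by rewrite gt_eqF// (pressure_gt0 m_gt1 u_sol)// ltW//= lexx.
by apply: cvg_trans L; apply: near_eq_cvg.
Qed.

End Endpoint.

Theorem theorem5 (R : realType) (n : nat) (M : topologicalType)
    (A : smooth_manifold R n M) (G : riemannian_metric A)
    (M_compact : compact [set: M])
    (psi : M -> R) (psi_smooth : smooth_fun A psi)
    (m T : R) (m_gt1 : 1 < m) (T_gt0 : 0 < T)
    (u : R -> M -> R) (u_sol : positive_pme_solution G psi m T u)
    (N : \bar R) (N_adm : admissible_dimension n m N)
    (psi_cst : N = (n%:R)%:E -> exists c, forall p, psi p = c)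
    (Ric_ge0 : weighted_ricci_ge0 G psi N) :
  let v : R -> M -> R := fun t p => m / (m - 1) * u t p `^ (m - 1) in
  forall (t : R) (i : chart A) (p : M), 0 < t <= T -> dom A i p ->
    grad_dot G i (v t) (v t) p / v t p - dtime `]0, T] (v^~ p) t / v t p
      <= ab_constant m N / t.
Proof.
move=> v t i p tT ip; change (ab_quantity G m T u i t p <= ab_constant m N / t).
have inner s : 0 < s < T -> ab_quantity G m T u i s p <= ab_constant m N / s.
  by move=> sT; exact: (interior_bound M_compact psi_smooth m_gt1 u_sol N_adm psi_cst Ric_ge0).
have /andP[t0] := tT; rewrite le_eqVlt => /orP[/eqP tE|tltT]; last first.
  by apply: inner; rewrite t0.
rewrite tE ler_pdivlMr//.
have cT : s @[s --> T^'-] --> T by exact: cvg_within.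
have L := cvgM (ab_quantity_cvg m_gt1 T_gt0 u_sol ip) cT.
apply: (cvgr_to_le (L _)).
have TT : 0 < T <= T by rewrite T_gt0 lexx.
apply: filterS (left_halfopen TT) => s [sT]; rewrite /= in_itv /= => /andP[s0 _].
by rewrite -ler_pdivlMr// inner// s0.
Qed.
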